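(* Let $B_n$ denote the number of minimal balanced collections on $[n]=\{1,\dots,n\}$. Then, as $n\to\infty$, $$B_n=\frac{2^{n^2-n+1}}{n!}\bigl(1+o(1)\bigr).$$
   Context: For a positive integer $n$, a collection (set of subsets) $\Phi\subseteq 2^{[n]}$ is called balanced if there exist positive real weights $(\lambda_S)_{S\in\Phi}$ such that $\sum_{S\in\Phi}\lambda_S\mathbf{1}_S=\mathbf{1}$, where $\mathbf{1}_S\in\{0,1\}^n$ is the characteristic vector of $S$ and $\mathbf{1}=(1,\dots,1)^{\mathsf T}\in\mathbb{R}^n$. A balanced collection is minimal if none of its proper subcollections is balanced. *)

(* Defs.v *)
From mathcomp Require Import all_boot all_order all_algebra.
From mathcomp Require Import boolp reals topology normedtype sequences.

Set Implicit Arguments.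
Unset Strict Implicit.
Unset Printing Implicit Defensive.

Import Order.TTheory GRing.Theory Num.Theory.
Import numFieldNormedType.Exports.

Local Open Scope ring_scope.

Definition char_vec (R : realType) (n : nat) (S : {set 'I_n}) : 'cV[R]_n :=
  \col_i (i \in S)%:R.

(* The weights are a total function on subsets; only its values on members of
   Phi matter. *)
Definition balanced (R : realType) (n : nat) (Phi : {set {set 'I_n}}) : Prop :=
  exists lambda : {set 'I_n} -> R,
    {in Phi, forall S, 0 < lambda S} /\
    \sum_(S in Phi) lambda S *: char_vec R S = const_mx 1.

Definition minimal_balanced (R : realType) (n : nat)
    (Phi : {set {set 'I_n}}) : Prop :=
  balanced R Phi /\
  forall Psi : {set {set 'I_n}}, Psi \proper Phi -> ~ balanced R Psi.

(* Minimal balancedness quantifies over real weights, so it is turned into a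
   boolean classically in order to be counted. *)
Definition num_minimal_balanced (R : realType) (n : nat) : nat :=
  #|[set Phi : {set {set 'I_n}} | `[< minimal_balanced R Phi >]]|.

(* Main.v *)
Require Import Defs.
From mathcomp Require Import all_boot all_order all_algebra.
From mathcomp Require Import zify ring lra.
From mathcomp Require Import boolp reals.

Import Order.TTheory GRing.Theory Num.Theory.

Local Open Scope ring_scope.

(* Write v_S for the sign vector of S (1 on S, -1 elsewhere).  A positive
   solution of sum_i lambda_i 1_{S_i} = 1 is a linear relation
   sum_i mu_i v_{S_i} = c 1 with positive mu, and replacing S_i by its complement
   flips the sign of mu_i.  Hence among the 2^k tuples obtained from
   (S_1, ..., S_k) by complementing some of the sets at most two, opposite to
   each other, are minimal balanced, and for k = n exactly two are as soon as
   every relation has only nonzero mu_i.  Replacing one v_{S_i} by 1, that fails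
   for a proportion of tuples at most n P_n, where P_n is the probability that an
   n x n sign matrix is singular.  Collections with fewer than n members are
   negligible, so what remains is n P_n -> 0.

   Let a be a kernel vector, m the largest number of coordinates of a with the
   same absolute value.  Unless a has few nonzero coordinates, a random row is
   orthogonal to a with probability rho = O(m n^{-3/2}) (atom_bound).  Exposing
   the rows one at a time, a subspace W of codimension m - 1 contains such a
   kernel vector with probability at most about (rho log n)^m, since a row fails
   to cut the current subspace, of dimension c, with probability at most
   min(rho, 2^{-c}).  There are at most (8n/m)^m subspaces W to consider, whence
   a bound (C n^{-1/2} log n)^m, which is summed over m >= 3; for m <= 2 one takes
   W to be the whole space. *)

(** * Antichains and the size of binomial coefficients *)

(** Induction on [#|U|]. If [U] is not a member, add up over [x] in [U] the inequalities for the
    members avoiding [x]: a member [A] occurs [n + 1 - #|A|] times, and [(n + 1) / C(n + 1, #|A|) =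
    (n + 1 - #|A|) / C(n, #|A|)]. *)
Lemma lym (R : realFieldType) (T : finType) (U : {set T}) (F : {set {set T}}) :
    {in F, forall A : {set T}, A \subset U} ->
    {in F &, forall A B : {set T}, A \subset B -> A = B} ->
  \sum_(A in F) (('C(#|U|, #|A|))%:R : R)^-1 <= 1.
Proof.
move: {2}#|U| (erefl #|U|) => n; elim: n U F => [|n IHn] U F cU FU antiF;
  have [UF|UnF] := boolP (U \in F).
- rewrite (_ : F = [set U]) ?big_set1 ?binn ?invr1 //.
  apply/setP => A; rewrite inE; apply/idP/eqP => [AF|->//].
  exact: antiF (FU _ AF).
- rewrite big1 ?ler01 // => A AF; case/negP: UnF.
  have := FU _ AF; move/eqP: cU; rewrite cards_eq0 => /eqP ->.
  by rewrite subset0 => /eqP <-.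
- rewrite (_ : F = [set U]) ?big_set1 ?binn ?invr1 //.
  apply/setP => A; rewrite inE; apply/idP/eqP => [AF|->//].
  exact: antiF (FU _ AF).
have nz : (n.+1%:R : R) != 0 by rewrite pnatr_eq0.
rewrite -(ler_pM2l (x := n.+1%:R)) ?ltr0n // mulr1 mulr_sumr.
have E A : A \in F -> n.+1%:R * ('C(#|U|, #|A|)%:R : R)^-1 =
    \sum_(x in U | x \notin A) ('C(n, #|A|)%:R)^-1.
  move=> AF; have AU := FU _ AF.
  have ltA : (#|A| <= n)%N.
    rewrite -ltnS -cU proper_card // properEneq AU andbT.
    by apply: contraNneq UnF => <-.
  have cD : #|U :\: A| = (n.+1 - #|A|)%N by rewrite cardsDS // cU.
  rewrite (eq_bigl (mem (U :\: A))); last by move=> x; rewrite !inE andbC.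
  rewrite sumr_const cD.
  have b0 : ('C(n, #|A|)%:R : R) != 0 by rewrite pnatr_eq0 -lt0n bin_gt0.
  have b1 : ('C(n.+1, #|A|)%:R : R) != 0.
    by rewrite pnatr_eq0 -lt0n bin_gt0 ltnW.
  have := mul_bin_down n.+1 #|A| => /= /(congr1 (fun k => k%:R : R)).
  rewrite !natrM => e; rewrite -[RHS]mulr_natl cU.
  by apply: (mulIf b1); apply: (mulIf b0); rewrite mulfVK // e mulrAC mulfVK // mulrC.
rewrite (eq_bigr _ E) (exchange_big_dep (mem U)) //=; last by move=> A x _ /andP[].
rewrite -cU -sum1_card natr_sum; apply: ler_sum => x xU.
rewrite (eq_bigl (fun A => A \in [set A in F | x \notin A])); last first.
  by move=> A; rewrite inE xU.
have -> : n = #|U :\ x| by move: (cardsD1 x U); rewrite cU xU => -[].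
apply: IHn.
- by move: (cardsD1 x U); rewrite cU xU => -[].
- move=> A; rewrite inE => /andP[AF xA]; apply/subsetP => y yA.
  rewrite !inE (subsetP (FU _ AF)) // andbT.
  by apply: contraNneq xA => <-.
- by move=> A B; rewrite !inE => /andP[AF _] /andP[BF _]; exact: antiF.
Qed.

Lemma bin_up (n k : nat) : (k.*2 < n)%N -> ('C(n, k) <= 'C(n, k.+1))%N.
Proof.
move=> lt; have := mul_bin_left n k => e.
rewrite -(leq_pmul2l (m := k.+1)) // e leq_mul2r; apply/orP; right; lia.
Qed.

Lemma leq_bin_central (m k : nat) : ('C(m.*2, k) <= 'C(m.*2, m))%N.
Proof.
suff H j : (j <= m)%N -> ('C(m.*2, m - j) <= 'C(m.*2, m))%N.
  have [km|mk] := leqP k m; first by rewrite -(subKn km) H ?leq_subr.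
  have [k2|k2] := leqP k m.*2; last by rewrite bin_small.
  rewrite -bin_sub // (_ : m.*2 - k = m - (k - m))%N; last by lia.
  by apply: H; lia.
elim: j => [|j IHj] lej; first by rewrite subn0.
apply: leq_trans (IHj (ltnW lej)).
have -> : (m - j = (m - j.+1).+1)%N by lia.
by apply: bin_up; lia.
Qed.

(** By [(m + 1) C(2m + 2, m + 1) = 2 (2m + 1) C(2m, m)], the induction step amounts to
    [(2m + 1) (2m + 3) <= (2m + 2)^2]. *)
Lemma central_bin_bound (m : nat) : ('C(m.*2, m) ^ 2 * m.*2.+1 <= 16 ^ m)%N.
Proof.
elim: m => // m IHm.
have e : (m.+1 * 'C(m.+1.*2, m.+1) = (m.*2.+1).*2 * 'C(m.*2, m))%N.
  rewrite doubleS; have := mul_bin_diag m.*2.+2 m; have := mul_bin_down m.*2.+1 m => /=.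
  by have -> : (m.*2.+1 - m = m.+1)%N; [lia | nia].
rewrite [(16 ^ _)%N]expnS; move: IHm; set a := 'C(m.*2, m) in e *.
set b := 'C(m.+1.*2, _) in e *; move: (16 ^ m)%N => N IHm.
have: (m.+1 ^ 2 * (b ^ 2 * m.+1.*2.+1) <= m.+1 ^ 2 * (16 * N))%N.
  rewrite mulnA -expnMn e expnMn.
  apply: (@leq_trans (m.+1 ^ 2 * 16 * (a ^ 2 * m.*2.+1))); last first.
    by rewrite -mulnA !leq_mul2l IHm !orbT.
  have: ((m.*2.+1).*2 ^ 2 * m.+1.*2.+1 <= m.+1 ^ 2 * 16 * m.*2.+1)%N by nia.
  move=> h; rewrite mulnAC [leqRHS]mulnA [leqRHS]mulnAC leq_mul2r h; exact: orbT.
by rewrite leq_pmul2l ?expn_gt0.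
Qed.

(** This is [C(h, k) <= 2^h / sqrt h], squared to stay within the natural numbers. For odd [h],
    Pascal's rule bounds the coefficient by twice the central one of the row before. *)
Lemma bin_bound (h k : nat) : ('C(h, k) ^ 2 * h <= 4 ^ h)%N.
Proof.
rewrite -[h]odd_double_half; move: (odd h) (h./2) => b m {h}.
have c := central_bin_bound m.
have -> : (4 ^ (b + m.*2) = 4 ^ b * 16 ^ m)%N.
  by rewrite expnD -muln2 mulnC [(m * 2)%N]mulnC expnM mulnC.
case: b => /=; last first.
  rewrite !add0n mul1n; apply: leq_trans c; apply: leq_mul => //.
  by rewrite leq_exp2r // leq_bin_central.
rewrite add1n; have: ('C(m.*2.+1, k) <= 'C(m.*2, m).*2)%N.
  case: k => [|k]; last first.
    by rewrite binS; have := leq_bin_central m k.+1; have := leq_bin_central m k; lia.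
  have := leq_bin_central m 0; rewrite !bin0; lia.
rewrite -(@leq_exp2r _ _ 2) // => h.
apply: (@leq_trans ('C(m.*2, m).*2 ^ 2 * m.*2.+1)); first by rewrite leq_mul2r h orbT.
by rewrite expn1; move: c; rewrite !expnS !expn0 !muln1; nia.
Qed.

(** By [bin_bound] each member contributes at least [sqrt #|H| / 2^#|H|] to the sum in [lym]. *)
Lemma antichain_card (R : rcfType) (T : finType) (H : {set T}) (F : {set {set T}}) :
    (0 < #|H|)%N ->
    {in F, forall A : {set T}, A \subset H} ->
    {in F &, forall A B : {set T}, A \subset B -> A = B} ->
  #|F|%:R <= 2 ^+ #|H| / Num.sqrt #|H|%:R :> R.
Proof.
move=> h0 FH antiF; have := lym R T H F FH antiF.
have sq0 : 0 < Num.sqrt (#|H|%:R : R) by rewrite sqrtr_gt0 ltr0n.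
rewrite ler_pdivlMr //.
suff le A : A \in F -> Num.sqrt #|H|%:R / 2 ^+ #|H| <= ('C(#|H|, #|A|)%:R : R)^-1.
  have e := ler_sum (index_enum _) le; move: e; rewrite sumr_const => e f.
  have := le_trans e f; rewrite -[leLHS]mulr_natr mulrAC ler_pdivrMr ?exprn_gt0 //.
  by rewrite mul1r mulrC.
move=> AF; have C0 : (0 : R) < 'C(#|H|, #|A|)%:R.
  by rewrite ltr0n bin_gt0 subset_leq_card // FH.
rewrite ler_pdivrMr ?exprn_gt0 // mulrC ler_pdivlMr //.
rewrite -(ler_pXn2r (n := 2)) ?nnegrE ?mulr_ge0 ?sqrtr_ge0 ?ler0n ?exprn_ge0 //.
have b : ('C(#|H|, #|A|)%:R : R) ^+ 2 * #|H|%:R <= 4 ^+ #|H|.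
  by rewrite -!natrX -natrM ler_nat bin_bound.
rewrite exprMn sqr_sqrtr ?ler0n // mulrC -exprM mulnC exprM.
have -> : (2 : R) ^+ 2 = 4 by ring.
by [].
Qed.

(** * Small-ball estimates for signed sums *)

Definition symd {n : nat} (S B : {set 'I_n}) : {set 'I_n} :=
  [set j | (j \in S) (+) (j \in B)].

Lemma symdK {n : nat} (B : {set 'I_n}) : involutive (symd^~ B).
Proof. by move=> S; apply/setP => j; rewrite !inE -addbA addbb addbF. Qed.

(** Scalar product of [a] with the sign vector of [S]. *)
Definition dotS {R : pzRingType} {n : nat} (S : {set 'I_n}) (a : 'rV[R]_n) : R :=
  \sum_j (if j \in S then a 0 j else - a 0 j).

Lemma dotS_symd {R : pzRingType} {n : nat} (S B : {set 'I_n}) (a : 'rV[R]_n) :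
  dotS (symd S B) a = dotS S (\row_j (if j \in B then - a 0 j else a 0 j)).
Proof.
by apply: eq_bigr => j _; rewrite !inE mxE; case: (j \in S); case: (j \in B); rewrite /= ?opprK.
Qed.

Lemma dotS_symd1 {R : pzRingType} {n : nat} (S : {set 'I_n}) (i : 'I_n) (a : 'rV[R]_n) :
  dotS (symd S [set i]) a = dotS S a - (if i \in S then a 0 i else - a 0 i) *+ 2.
Proof.
rewrite /dotS (bigD1 i) //= [in RHS](bigD1 i) //= !inE eqxx addbT.
rewrite (eq_bigr (fun j => if j \in S then a 0 j else - a 0 j)); last first.
  by move=> j ji; rewrite !inE (negPf ji) addbF.
rewrite mulr2n addrAC; congr (_ + _).
by case: (i \in S); rewrite /= opprD addrA subrr sub0r ?opprK.
Qed.

(* Once the trace of S outside H is fixed, the traces on H form an antichain. *)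
Lemma small_ball_pos (R : rcfType) (n : nat) (a : 'rV[R]_n) (H : {set 'I_n})
    (delta t : R) :
    0 < delta -> (0 < #|H|)%N -> {in H, forall j, delta <= a 0 j} ->
  #|[set S | t <= dotS S a < t + delta *+ 2]|%:R <= 2 ^+ n / Num.sqrt #|H|%:R :> R.
Proof.
move=> d0 h0 aH; set E := [set S | _].
(* Each trace outside [H] receives the share [2^#|H|] of the total [2^n]. *)
have -> : (2 : R) ^+ n = (2 ^+ #|H|) *+ #|powerset (~: H)|.
  rewrite card_powerset -[RHS]mulr_natr natrX -exprD; congr (_ ^+ _).
  by rewrite cardsC card_ord.
rewrite -sum1_card natr_sum mulrnAl -sumr_const.
rewrite (partition_big (fun S => S :\: H) (mem (powerset (~: H)))) /=; last first.
  by move=> S _; rewrite inE setDE subsetIr.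
apply: ler_sum => U; rewrite inE => UH.
rewrite -natr_sum sum1_card.
have mem S : (S \in [pred S in E | S :\: H == U]) = (S \in E) && (S :\: H == U) by [].
set G := [set S in E | S :\: H == U].
rewrite (_ : #|_| = #|G|); last by apply: eq_card => S; rewrite inE.
have dec S : S \in G -> S = (S :&: H) :|: U.
  by rewrite inE => /andP[_ /eqP <-]; rewrite setID.
have inj : {in G &, injective (fun S => S :&: H)}.
  by move=> S S' /dec + /dec + e => -> ->; rewrite e.
rewrite -(card_in_imset inj); apply: antichain_card => //.
  by move=> A /imsetP[S _ ->]; rewrite subsetIr.
move=> A A' /imsetP[S SG ->] /imsetP[S' S'G ->] sub.
apply/eqP/negPn/negP => ne.
have [j jS' jS] : exists2 j, j \in S' :&: H & j \notin S :&: H.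
  by apply/subsetPn; apply: contra ne => s; rewrite eqEsubset sub s.
have SS' : S \subset S'.
  by rewrite (dec _ SG) (dec _ S'G) setSU.
have jH : j \in H by move: jS'; rewrite inE => /andP[].
move: jS' jS; rewrite !inE jH !andbT => jS' jS.
have SG' := SG; have S'G' := S'G.
move: SG' S'G'; rewrite !inE => /andP[/andP[l1 _] e1] /andP[/andP[_ l2] e2].
(* The extra element [j] raises the sum by at least [2 delta], the length of the half-open window,
   so [S] and [S'] cannot both lie in it. *)
have: dotS S a + delta *+ 2 <= dotS S' a.
  rewrite /dotS (bigD1 j) //= [leRHS](bigD1 j) //= (negPf jS) jS'.
  rewrite addrAC; apply: lerD; first by have := aH j jH; rewrite mulr2n; lra.
  apply: ler_sum => i _; have [iS|iS] := ifP.
    by rewrite (subsetP SS' _ iS).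
  have [iS'|//] := ifP.
  have: 0 < delta <= a 0 i; last by lra.
  rewrite d0 aH //; apply: contraFT iS => iH.
  have : i \in S' :\: H by rewrite inE iH.
  by rewrite (eqP e2) -(eqP e1) inE => /andP[].
by move=> h; have := le_lt_trans h l2; rewrite ltrD2r ltNge l1.
Qed.

(** Negating the coordinates where [a] is negative only permutes the sets [S], which reduces to the
    positive case. *)
Lemma small_ball (R : rcfType) (n : nat) (a : 'rV[R]_n) (H : {set 'I_n})
    (delta t : R) :
    0 < delta -> (0 < #|H|)%N -> {in H, forall j, delta <= `|a 0 j|} ->
  #|[set S | t <= dotS S a < t + delta *+ 2]|%:R <= 2 ^+ n / Num.sqrt #|H|%:R :> R.
Proof.
move=> d0 h0 aH; pose B := [set j | a 0 j < 0].
pose b := \row_j (if j \in B then - a 0 j else a 0 j).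
apply: le_trans (small_ball_pos _ _ b H _ t d0 h0 _); last first.
  move=> j /aH; rewrite mxE inE; case: ltP => l; first by rewrite ltr0_norm.
  by rewrite ger0_norm.
rewrite ler_nat -(card_imset _ (can_inj (symdK B))); apply: subset_leq_card.
apply/subsetP => S /imsetP[S' + ->]; rewrite !inE -(symdK B S') dotS_symd symdK.
by rewrite -/b.
Qed.

(** Take [d] with [f d] largest among the members that have at least half of [Z] at or above them.
    If more than half of [Z] were strictly above [d], the lowest of these would be a better
    choice. *)
Lemma median_abs (R : realDomainType) (T : finType) (f : T -> R) (Z : {set T}) :
    Z != set0 ->
  exists2 d, d \in Z &
    (#|Z| <= #|[set i in Z | (f d <= f i)%R]|.*2)%N /\
    (#|Z| <= #|[set i in Z | (f i <= f d)%R]|.*2)%N.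
Proof.
move=> /set0Pn[z0 z0Z].
pose up d := [set i in Z | f d <= f i].
pose P := [set d in Z | (#|Z| <= #|up d|.*2)%N].
have [m mZ mmin] := @arg_minP _ _ _ z0 (mem Z) f z0Z.
have mP : m \in P.
  have eZ : up m = Z.
    by apply/setP => i; rewrite inE; case iZ: (i \in Z) => //=; exact: mmin.
  by rewrite inE eZ; apply/andP; split => //; lia.
have [d dP dmax] := @arg_maxP _ _ _ m (mem P) f mP.
have: d \in P := dP; rewrite inE => /andP[dZ ud]; exists d => //; split => //.
pose V := [set i in Z | f d < f i]; set W := [set i in Z | f i <= f d].
have eU : V :|: W = Z.
  by apply/setP => i; rewrite !inE; case: (i \in Z) => //=; case: ltP.
have eI : V :&: W = set0.
  by apply/setP => i; rewrite !inE; case: (i \in Z) => //=; case: ltP.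
have cV := cardsUI V W; rewrite eU eI cards0 in cV.
suff: (#|V|.*2 <= #|Z|)%N by lia.
have [->|/set0Pn[v0 v0V]] := eqVneq V set0; first by rewrite cards0.
have [v vV vmin] := @arg_minP _ _ _ v0 (mem V) f v0V.
have: v \in V := vV; rewrite inE => /andP[vZ dv].
have eV : V = up v.
  apply/setP => i; rewrite !inE; case iZ: (i \in Z) => //=.
  apply/idP/idP => [di|]; last exact: lt_le_trans.
  by apply: vmin; have : i \in V by rewrite inE iZ.
rewrite leqNgt; apply/negP => lt.
have: v \in P by rewrite inE vZ -eV ltnW.
by move=> vP; have : f v <= f d := dmax v vP; rewrite leNgt dv.
Qed.

(* Let delta be the median of the nonzero |a_j|.  Flipping in a zero of dotS _ a a
   coordinate i with |a_i| <= delta yields y with |dotS y a| = 2 |a_i|, so that i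
   takes at most m values when y is known; and small_ball, applied to the
   coordinates with |a_i| >= delta, bounds the number of such y. *)
Lemma atom_bound (R : rcfType) (n m : nat) (a : 'rV[R]_n) :
    let s := #|[set j | a 0 j != 0]| in
    (0 < s)%N ->
    (forall c : R, 0 < c -> (#|[set j | (`|a 0 j| == c)%R]| <= m)%N) ->
  #|[set S | dotS S a == 0]|%:R
    <= (12 * m%:R / (s%:R * Num.sqrt s%:R)) * 2 ^+ n :> R.
Proof.
move=> s s0 level; pose Z := [set j | a 0 j != 0].
have Zn0 : Z != set0 by rewrite -card_gt0.
have [d dZ [upd downd]] := @median_abs R _ (fun j => `|a 0 j|) Z Zn0.
set delta := `|a 0 d| in upd downd.
have d0 : 0 < delta by move: dZ; rewrite inE /delta normr_gt0.
set H := [set i in Z | delta <= _] in upd.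
set L := [set i in Z | _ <= delta] in downd.
set N := [set S | dotS S a == 0]; pose Y := [set S | `|dotS S a| <= delta *+ 2].
have H0 : (0 < #|H|)%N by move: upd s0; rewrite -/s; lia.
have sqH : 0 < Num.sqrt (#|H|%:R : R) by rewrite sqrtr_gt0 ltr0n.
have sqs : 0 < Num.sqrt (s%:R : R) by rewrite sqrtr_gt0 ltr0n.
have cY : #|Y|%:R <= (2 ^+ n / Num.sqrt #|H|%:R) *+ 3 :> R.
  have aH : {in H, forall j, delta <= `|a 0 j|} by move=> j; rewrite inE => /andP[].
  have ball t := @small_ball R n a H delta t d0 H0 aH.
  pose E t := [set S | t <= dotS S a < t + delta *+ 2].
  (* Three windows of length [2 delta] cover the closed interval; the third is there for its right
     end. *)
  have sub : Y \subset E (- (delta *+ 2)) :|: E 0 :|: E (delta *+ 2).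
    apply/subsetP => S; rewrite !inE ler_norml => /andP[-> u] /=.
    by rewrite addNr add0r; case: (ltP _ 0) => //= l; case: ltP => //= l'; lra.
  apply: (@le_trans _ _ (#|E (- (delta *+ 2))|%:R + #|E 0|%:R + #|E (delta *+ 2)|%:R)).
    rewrite -!natrD ler_nat; apply: leq_trans (subset_leq_card sub) _.
    by apply: leq_trans (leq_card_setU _ _) _; rewrite leq_add2r leq_card_setU.
  by rewrite [leRHS]mulrSr mulr2n; do 2?apply: lerD; exact: ball.
have cN : (#|N| * #|L| <= #|Y| * m)%N.
  rewrite mulnC -sum_nat_const -[leqRHS]sum_nat_const.
  apply: (@leq_trans (\sum_(i in L) #|[set y in Y | symd y [set i] \in N]|)).
    apply: leq_sum => i; rewrite inE => /andP[_ il].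
    rewrite -(card_imset _ (can_inj (symdK [set i]))); apply: subset_leq_card.
    apply/subsetP => y /imsetP[S SN ->]; rewrite inE symdK SN andbT.
    move: SN; rewrite !inE dotS_symd1 => /eqP ->; rewrite sub0r normrN normrMn.
    by rewrite (_ : `|_| = `|a 0 i|) ?lerMn2r //; case: ifP => // _; rewrite normrN.
  under eq_bigr do rewrite -sum1_card.
  under eq_bigr do under eq_bigl do rewrite inE.
  rewrite (exchange_big_dep (mem Y)) /=; last by move=> i y _ /andP[].
  apply: leq_sum => y yY; rewrite sum1_card.
  (* The bound on level sets is for positive values only. If [dotS y a = 0], flipping a nonzero
     coordinate never leads to a zero. *)
  have [y0|y0] := eqVneq (dotS y a) 0.
    rewrite eq_card0 // => i; apply/negP => /and3P[].
    rewrite !inE => /andP[ai0 _] _; rewrite dotS_symd1 y0 sub0r oppr_eq0.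
    by rewrite mulrn_eq0 /=; case: ifP; rewrite ?oppr_eq0 => _; exact/negP.
  apply: leq_trans (level (`|dotS y a| / 2) _); last by rewrite divr_gt0 ?normr_gt0.
  apply: subset_leq_card; apply/subsetP => i /and3P[_ _].
  rewrite !inE dotS_symd1 subr_eq0 => /eqP ->.
  rewrite normrMn -[_ *+ 2]mulr_natr mulfK ?pnatr_eq0 //.
  by case: ifP => // _; rewrite normrN.
move: cN; rewrite -(ler_nat R) !natrM => cN.
have m0 : 0 <= m%:R :> R by [].
(* The constant 12 collects a 2 from [L], a 2 from the square root of [#|H|], and the 3 windows. *)
have hL : s%:R <= 2 * #|L|%:R :> R by rewrite -natrM ler_nat; move: downd; rewrite -/s; lia.
have hH : Num.sqrt s%:R <= 2 * Num.sqrt #|H|%:R :> R.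
  rewrite -(ler_pXn2r (n := 2)) ?nnegrE ?mulr_ge0 ?sqrtr_ge0 //.
  rewrite exprMn !sqr_sqrtr // -natrX -natrM ler_nat.
  by move: upd; rewrite -/s; lia.
have hY : #|Y|%:R * Num.sqrt s%:R <= 6 * 2 ^+ n :> R.
  apply: (@le_trans _ _ (#|Y|%:R * (2 * Num.sqrt #|H|%:R))); first by rewrite ler_wpM2l.
  move: cY; rewrite -[_ *+ 3]mulr_natr mulrAC ler_pdivlMr //; lra.
rewrite mulrAC ler_pdivlMr ?mulr_gt0 ?ltr0n //.
apply: (@le_trans _ _ (2 * (#|N|%:R * #|L|%:R) * Num.sqrt s%:R)).
  by rewrite [leLHS]mulrA ler_wpM2r ?sqrtr_ge0 // [leRHS]mulrCA ler_wpM2l.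
apply: (@le_trans _ _ (2 * (#|Y|%:R * m%:R) * Num.sqrt s%:R)).
  by rewrite ler_wpM2r ?sqrtr_ge0 // ler_wpM2l.
have := ler_wpM2l m0 hY; lra.
Qed.

(** * Sign vectors orthogonal to a vector of a given subspace *)

Definition sgv (R : pzRingType) {n : nat} (S : {set 'I_n}) : 'rV[R]_n :=
  \row_j (if j \in S then 1 else -1).

Lemma dotSE {R : comPzRingType} {n : nat} (S : {set 'I_n}) (a : 'rV[R]_n) :
  (dotS S a == 0) = (a *m (sgv R S)^T == 0).
Proof.
rewrite (_ : a *m _ = (dotS S a)%:M).
  apply/eqP/eqP => [->|]; first by rewrite raddf0.
  by move/matrixP/(_ 0 0); rewrite !mxE eqxx mulr1n.
apply/matrixP => i j; rewrite !ord1 !mxE eqxx mulr1n; apply: eq_bigr => k _.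
by rewrite !mxE; case: ifP => _; rewrite ?mulr1 // mulrN1.
Qed.

(** [D] stands for its row space; taking it square gives all subspaces one type, whatever their
    dimension. *)
Definition orth_tuples (R : fieldType) {n : nat} (P : 'rV[R]_n -> Prop) (k : nat)
    (D : 'M[R]_n) : {set {ffun 'I_k -> {set 'I_n}}} :=
  [set F : {ffun 'I_k -> {set 'I_n}} |
     `[< exists a, [/\ P a, (a <= D)%MS & forall i, dotS (F i) a = 0] >]].

Lemma card_sets (n : nat) : #|{: {set 'I_n}}| = (2 ^ n)%N.
Proof.
have := card_powerset [set: 'I_n]; rewrite cardsT card_ord => <-.
by apply: eq_card => S; rewrite !inE subsetT.
Qed.

(* Rows are exposed one at a time.  Phi k c bounds the probability that k rows
   leave a vector of P in a subspace of dimension c; the next row either misses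
   the chance to cut the subspace (probability at most p c) or makes its dimension
   drop. *)
Lemma card_orth_tuples (R : realFieldType) (n : nat) (P : 'rV[R]_n -> Prop)
    (p : nat -> R) (Phi : nat -> nat -> R) :
    (forall a, P a -> a != 0) ->
    (forall a (D : 'M[R]_n), P a -> (a <= D)%MS ->
      #|[set S | D *m (sgv R S)^T == 0]|%:R <= p (\rank D) * 2 ^+ n) ->
    (forall k c, 0 <= Phi k c) ->
    (forall k c c', (c <= c')%N -> Phi k c <= Phi k c') ->
    (forall c, 1 <= Phi 0%N c.+1) ->
    (forall k c, p c.+1 * Phi k c.+1 + Phi k c <= Phi k.+1 c.+1) ->
  forall k (D : 'M[R]_n), #|orth_tuples R P k D|%:R <= Phi k (\rank D) * 2 ^+ (n * k).
Proof.
move=> Pn0 Pp Phi0 Phim base step; elim=> [|k IHk] D;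
  have [[a [Pa aD]]|noa] := pselect (exists a, P a /\ (a <= D)%MS); last 1 first.
- rewrite (_ : orth_tuples _ _ _ _ = set0) ?cards0 ?mulr_ge0 ?exprn_ge0 //.
  by apply/setP => F; rewrite !inE; apply/asboolP => -[a [Pa aD _]]; apply: noa; exists a.
- have: (0 < \rank D)%N.
    rewrite lt0n mxrank_eq0; apply: contra_neq (Pn0 _ Pa) => D0.
    by apply/eqP; move: aD; rewrite D0 submx0.
  case: (\rank D) => // c _; rewrite muln0 expr0 mulr1.
  apply: le_trans (base c); rewrite -[1]/(1%:R) ler_nat; apply: leq_trans (max_card _) _.
  by rewrite card_ffun card_ord expn0.
- rewrite (_ : orth_tuples _ _ _ _ = set0) ?cards0 ?mulr_ge0 ?exprn_ge0 //.
  by apply/setP => F; rewrite !inE; apply/asboolP => -[a [Pa aD _]]; apply: noa; exists a.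
have: (0 < \rank D)%N.
  rewrite lt0n mxrank_eq0; apply: contra_neq (Pn0 _ Pa) => D0.
  by apply/eqP; move: aD; rewrite D0 submx0.
have hp := Pp _ _ Pa aD; case rD: (\rank D) hp => [//|c] hp _.
pose cut S := (D :&: kermx (sgv R S)^T)%MS.
(* Once the first set is known to be [S], dropping it is injective, and the orthogonal vector lies
   in the subspace cut by [S]. *)
have fib S : (#|[set F in orth_tuples R P k.+1 D | F ord0 == S]| <=
              #|orth_tuples R P k (cut S)|)%N.
  pose tl (F : {ffun 'I_k.+1 -> {set 'I_n}}) := [ffun i : 'I_k => F (lift ord0 i)].
  rewrite -(card_in_imset (f := tl)).
    apply: subset_leq_card; apply/subsetP => G /imsetP[F + ->]; rewrite !inE.
    move=> /andP[/asboolP[b [Pb bD ob]] /eqP F0]; apply/asboolP; exists b; split => //.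
      by rewrite sub_capmx bD sub_kermx -dotSE -F0 ob eqxx.
    by move=> i; rewrite ffunE ob.
  move=> F F'; rewrite !inE => /andP[_ /eqP F0] /andP[_ /eqP F0'] /ffunP e.
  apply/ffunP => i; case: (unliftP ord0 i) => [j|] ->; last by rewrite F0 F0'.
  by have := e j; rewrite !ffunE.
have rk S : (\rank (cut S) <= c.+1)%N by rewrite -rD mxrankS // capmxSl.
have rk' S : S \notin [set S | D *m (sgv R S)^T == 0] -> (\rank (cut S) <= c)%N.
  rewrite inE -ltnS -rD => nS; apply: rank_ltmx.
  rewrite ltmxE capmxSl /=; apply: contra nS => /submx_trans/(_ (capmxSr _ _)).
  by rewrite sub_kermx.
set X := [set S | _] in hp rk'.
have q0 : 0 <= 2 ^+ (n * k) :> R by rewrite exprn_ge0.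
apply: (@le_trans _ _ (\sum_(S : {set 'I_n})
    (if S \in X then Phi k c.+1 else Phi k c) * 2 ^+ (n * k))).
  rewrite -sum1_card natr_sum (partition_big (fun F : {ffun _} => F ord0) predT) //=.
  apply: ler_sum => S _; rewrite -natr_sum sum1_card.
  apply: (@le_trans _ _ #|orth_tuples R P k (cut S)|%:R).
    rewrite ler_nat; apply: leq_trans (fib S); apply: eq_leq.
    by apply: eq_card => F; rewrite [in RHS]inE.
  apply: le_trans (IHk _) _; rewrite ler_wpM2r //.
  by case: ifP => SX; apply: Phim; rewrite ?rk ?rk' ?SX.
rewrite -mulr_suml mulnS exprD [in leRHS]mulrA ler_wpM2r //.
rewrite (bigID (mem X)) /= (eq_bigr (fun=> Phi k c.+1)); last by move=> S ->.
rewrite sumr_const [X in _ + X](eq_bigr (fun=> Phi k c)); last by move=> S /negPf ->.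
rewrite sumr_const -[X in _ + X]mulr_natl -[X in X + _]mulr_natl; set Y := (#|_| in X in _ + X).
have q1 : Y%:R <= 2 ^+ n :> R.
  by rewrite -natrX ler_nat; apply: leq_trans (max_card _) _; rewrite card_sets.
have h1 := ler_wpM2r (Phi0 k c.+1) hp; have h2 := ler_wpM2r (Phi0 k c) q1.
have q2 : 0 <= 2 ^+ n :> R by rewrite exprn_ge0.
have h3 := ler_wpM2r q2 (step k c); lra.
Qed.

(* Odlyzko's bound: c suitable coordinates of S are determined by the others. *)
Lemma card_sign_orth (R : realFieldType) (n : nat) (D : 'M[R]_n) :
  #|[set S | D *m (sgv R S)^T == 0]|%:R <= 2 ^- \rank D * 2 ^+ n :> R.
Proof.
set X := [set S | _]; set c := \rank D.
have full : row_full (row_base D)^T.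
  by rewrite /row_full mxrank_tr eq_row_base.
(* [J] indexes [c] columns of a basis of [D] that form an invertible matrix. *)
pose f := fullrankfun full; pose J := [set f i | i : 'I_c].
have cJ : #|J| = c by rewrite card_imset ?card_ord //; exact: fullrankfun_inj.
have inj : {in X &, injective (fun S => S :\: J)}.
  move=> S S'; rewrite !inE => /eqP oS /eqP oS' e.
  (* If the two sets agree outside [J], then [w] is supported on [J] and orthogonal to [D], so the
     invertible minor forces it to vanish. *)
  pose w := sgv R S - sgv R S'.
  have wJ j : j \notin J -> w 0 j = 0.
    move=> jJ; move/setP/(_ j): e; rewrite !inE jJ /= !mxE => ->.
    by rewrite subrr.
  have wA : w *m (row_base D)^T = 0.
    have wT : w^T = (sgv R S)^T - (sgv R S')^T by rewrite /w linearB.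
    have /submxP[E ->] : (row_base D <= D)%MS by rewrite eq_row_base.
    apply: trmx_inj; rewrite trmx_mul trmxK -mulmxA wT mulmxBr oS oS' subrr.
    by rewrite mulmx0 trmx0.
  have wf : (\row_i w 0 (f i)) *m rowsub f (row_base D)^T = 0.
    rewrite -wA; apply/matrixP => i j; rewrite !mxE.
    rewrite [RHS](bigID (mem J)) /= [X in _ = _ + X]big1 ?addr0; last first.
      by move=> k kJ; rewrite ord1 wJ ?mul0r.
    rewrite big_imset /=; last by move=> x y _ _; exact: fullrankfun_inj.
    by apply: eq_big => [k|k _]; rewrite ?inE // ord1 !mxE.
  have w0 : \row_i w 0 (f i) = 0.
    have := congr1 (mulmx^~ (invmx (rowsub f (row_base D)^T))) wf.
    by rewrite mulmxK ?fullrowsub_unit // mul0mx.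
  have {wJ} w0' j : w 0 j = 0.
    have [/imsetP[i _ ->]|/wJ//] := boolP (j \in J).
    by move/matrixP/(_ 0 i): w0; rewrite !mxE.
  apply/setP => j; move: (w0' j); rewrite !mxE.
  have two : (1 + 1 : R) != 0 by rewrite -(natrD R 1 1) pnatr_eq0.
  case: ifP => _; case: ifP => _ // /eqP; first by rewrite opprK (negPf two).
  by rewrite -opprD oppr_eq0 (negPf two).
have le : (#|X| <= 2 ^ (n - c))%N.
  have -> : (n - c = #|~: J|)%N by have := cardsC J; rewrite cJ card_ord; lia.
  rewrite -card_powerset -(card_in_imset inj); apply: subset_leq_card.
  by apply/subsetP => A /imsetP[S _ ->]; rewrite inE setDE subsetIr.
rewrite mulrC -expfB_cond; last by rewrite pnatr_eq0 /= rank_leq_row.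
by rewrite -natrX ler_nat.
Qed.

(* The recursion of card_orth_tuples is solved by x ^ (k + 1 - c) * G c for any G
   with G c - G c.-1 >= p c / x * G c. *)
Lemma card_orth_tuples_geom (R : realFieldType) (n : nat) (P : 'rV[R]_n -> Prop)
    (p : nat -> R) (x : R) :
    (forall a, P a -> a != 0) ->
    (forall a (D : 'M[R]_n), P a -> (a <= D)%MS ->
      #|[set S | D *m (sgv R S)^T == 0]|%:R <= p (\rank D) * 2 ^+ n) ->
    (forall c, 0 <= p c) -> 0 < x <= 1 -> p 1%N <= x ->
    (forall c, 4 * \sum_(i < c) p i.+2 <= 3 * x) ->
  forall k (D : 'M[R]_n),
  #|orth_tuples R P k D|%:R <= 4 * x ^+ k.+1 / x ^+ \rank D * 2 ^+ (n * k).
Proof.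
move=> Pn0 Pp p0 /andP[x0 x1] p1 px k D; have x0' := ltW x0.
(* The increments of [G] are [4 / x * p c], and the hypothesis on the sum of [p] keeps [G] between 1
   and 4; so they are at least [p c / x * G c]. *)
pose G c := 1 + 4 / x * \sum_(i < c.-1) p i.+2.
have S0 c : 0 <= \sum_(i < c) p i.+2 by apply: sumr_ge0.
have G1 c : 1 <= G c by rewrite lerDl mulr_ge0 // divr_ge0.
have G4 c : G c <= 4.
  suff: 4 / x * \sum_(i < c.-1) p i.+2 <= 3 by rewrite /G; lra.
  by rewrite mulrAC ler_pdivrMr.
have Gm c : G c <= G c.+1.
  rewrite lerD2l ler_wpM2l ?divr_ge0 //.
  by case: c => [|c] /=; rewrite ?lexx // [leRHS]big_ord_recr /= lerDl.
have xn m : 0 < x ^+ m by rewrite exprn_gt0.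
have xn' m := ltW (xn m); have G0 c := le_trans ler01 (G1 c).
(* The zero space contains no vector of [P]. The value 0 there lets the recursion in dimension 1
   need only [p 1 <= x]. *)
pose Phi j c := if c is 0%N then 0 else x ^+ j.+1 / x ^+ c * G c.
have Phi0 j c : 0 <= Phi j c.
  case: c => //= c; by rewrite mulr_ge0 ?divr_ge0.
apply: (@le_trans _ _ (Phi k (\rank D) * 2 ^+ (n * k))).
  apply: (@card_orth_tuples R n P p Phi) => //.
  - move=> j c c' le; rewrite -(subnK le); elim: (c' - c)%N => [|d IH]; first by rewrite add0n.
    apply: le_trans IH _; rewrite addSn; case: (d + c)%N => [|e]; first exact: Phi0.
    rewrite /Phi ler_pM ?divr_ge0 // ler_pM2l //.
    by rewrite lef_pV2 ?posrE // exprS ger_pMl.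
  - move=> c; rewrite /Phi expr1 exprS invfM mulrA divff ?gt_eqF // mul1r.
    rewrite -[1]mulr1 ler_pM // -invr1 lef_pV2 ?posrE // exprn_ile1 // ltW //.
  - move=> j [|c]; rewrite /Phi.
      have -> : G 1%N = 1 by rewrite /G /= big_ord0 mulr0 addr0.
      rewrite addr0 !mulr1 expr1 [x ^+ j.+2]exprS -mulrA.
      by rewrite ler_wpM2r // divr_ge0.
    set y := x ^+ j.+1 / x ^+ c.+2.
    have -> : x ^+ j.+1 / x ^+ c.+1 = y * x.
      by rewrite /y [x ^+ c.+2]exprS invfM mulrA [_ / x / _]mulrAC mulfVK ?gt_eqF.
    have -> : x ^+ j.+2 / x ^+ c.+2 = y * x by rewrite /y [x ^+ j.+2]exprS -mulrA mulrC.
    have y0 : 0 < y by rewrite divr_gt0.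
    have -> : G c.+2 = G c.+1 + 4 / x * p c.+2 by rewrite /G /= big_ord_recr mulrDr addrA.
    have := G4 c.+2; rewrite {1}/G /= big_ord_recr /= mulrDr addrA -/(G c.+1) => g4.
    have -> : y * x * (G c.+1 + 4 / x * p c.+2) = y * x * G c.+1 + 4 * (y * p c.+2).
      by field; rewrite gt_eqF.
    rewrite addrC lerD2l [leLHS]mulrA [p _ * y]mulrC [leLHS]mulrC.
    by rewrite ler_wpM2r // mulr_ge0 // ltW.
rewrite ler_wpM2r ?exprn_ge0 // /Phi; case: (\rank D) => [|c].
  by rewrite expr0 divr1 mulr_ge0 // ltW.
by rewrite mulrC -mulrA ler_wpM2r // divr_ge0 // ltW.
Qed.

(** Bound the first [l] terms by [rho]; the rest form a geometric tail of total at most [2^-l],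
    hence at most [rho]. *)
Lemma sum_min_geom (R : realFieldType) (rho : R) (l c : nat) :
  0 <= rho -> 2 ^- l <= rho ->
  \sum_(i < c) Num.min rho (2 ^- i.+2) <= l.+1%:R * rho.
Proof.
move=> r0 hl.
have h d : \sum_(i < l + d) Num.min rho (2 ^- i.+2) <= l%:R * rho + 2 ^- l - 2 ^- (l + d).
  elim: d => [|d IHd].
    rewrite addn0 addrK; apply: (@le_trans _ _ (\sum_(i < l) rho)).
      by apply: ler_sum => i _; rewrite ge_min lexx.
    by rewrite sumr_const card_ord mulr_natl.
  rewrite addnS big_ord_recr /=.
  have: Num.min rho (2 ^- (l + d).+2) <= 2 ^- (l + d).+2 by rewrite ge_min lexx orbT.
  rewrite !exprS !invfM.
  have : 0 <= (2 ^+ (l + d))^-1 :> R by rewrite invr_ge0 exprn_ge0.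
  lra.
apply: (@le_trans _ _ (\sum_(i < l + c) Num.min rho (2 ^- i.+2))).
  rewrite addnC big_split_ord /= lerDl; apply: sumr_ge0 => i _.
  by rewrite le_min r0 invr_ge0 exprn_ge0.
apply: le_trans (h c) _; rewrite -[l.+1%:R]natr1 mulrDl mul1r.
have : 0 <= (2 ^+ (l + c))^-1 :> R by rewrite invr_ge0 exprn_ge0.
lra.
Qed.

(** Here [p c] is the minimum of [rho] and [2^-c], since a row orthogonal to the subspace is
    orthogonal to the vector of [P] in it. These values add up to at most [(l + 1) rho], which
    permits the ratio [x = 2 (l + 1) rho]. *)
Lemma card_orth_tuples_atom (R : realFieldType) (n l : nat) (P : 'rV[R]_n -> Prop)
    (rho : R) :
    (forall a, P a -> a != 0) ->
    (forall a, P a -> #|[set S | dotS S a == 0]|%:R <= rho * 2 ^+ n) ->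
    2 ^- l <= rho -> 2 * l.+1%:R * rho <= 1 ->
  forall k (D : 'M[R]_n), #|orth_tuples R P k D|%:R <=
    4 * (2 * l.+1%:R * rho) ^+ k.+1 / (2 * l.+1%:R * rho) ^+ \rank D * 2 ^+ (n * k).
Proof.
move=> Pn0 Pr hl x1.
have r0 : 0 < rho by apply: lt_le_trans hl; rewrite invr_gt0 exprn_gt0.
have r0' := ltW r0.
have lr : rho <= l.+1%:R * rho by rewrite ler_peMl // ler1n.
apply: (@card_orth_tuples_geom R n P (fun c => Num.min rho (2 ^- c))) => //.
- move=> a D Pa aD.
  rewrite minr_pMl ?exprn_ge0 // le_min card_sign_orth andbT.
  apply: le_trans (Pr a Pa); rewrite ler_nat; apply: subset_leq_card.
  apply/subsetP => S; rewrite !inE dotSE => /eqP DS.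
  by case/submxP: aD => z ->; rewrite -mulmxA DS mulmx0.
- by move=> c; rewrite le_min r0' invr_ge0 exprn_ge0.
- by rewrite x1 andbT !mulr_gt0 ?ltr0n.
- by rewrite ge_min; apply/orP; left; lra.
- move=> c; have := @sum_min_geom R rho l c r0' hl; lra.
Qed.

(** Odlyzko's bound alone, meant for kernel vectors of small support. As [2^-2 + 2^-3 + ...] is 1/2,
    the least admissible ratio is 2/3. *)
Lemma card_orth_tuples_small (R : realFieldType) (n k : nat) (D : 'M[R]_n) :
  #|orth_tuples R (fun a => a != 0) k D|%:R <=
    4 * (2 / 3) ^+ k.+1 / (2 / 3) ^+ \rank D * 2 ^+ (n * k) :> R.
Proof.
apply: (@card_orth_tuples_geom R n _ (fun c => 2 ^- c)) => //.
- by move=> a D' _ _; exact: card_sign_orth.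
- by move=> c; rewrite invr_ge0 exprn_ge0.
- by lra.
- by rewrite expr1; lra.
- move=> c; suff: \sum_(i < c) (2 ^- i.+2 : R) <= 1 / 2 by lra.
  apply: (@le_trans _ _ (1 / 2 - 2 ^- c.+1)); last first.
    by rewrite gerBl invr_ge0 exprn_ge0.
  elim: c => [|c IHc]; first by rewrite big_ord0 expr1; lra.
  rewrite big_ord_recr /= [in leRHS]exprS [in _ + _]exprS !invfM; lra.
Qed.

(** * Classes of kernel vectors and the number of singular tuples *)

Lemma card_cover (I T : finType) (X : {set T}) (P : pred I) (A : I -> {set T}) :
  (forall x, x \in X -> exists2 i, P i & x \in A i) -> (#|X| <= \sum_(i | P i) #|A i|)%N.
Proof.
move=> cov; rewrite -sum1_card; under [leqRHS]eq_bigr do rewrite -sum1_card.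
rewrite (exchange_big_dep predT) //= big_mkcond /=; apply: leq_sum => x _.
case: ifP => // /cov[i Pi xi].
by rewrite (bigD1 i) ?Pi.
Qed.

Lemma ffact_le_exp (n m : nat) : (n ^_ m <= n ^ m)%N.
Proof.
elim: m n => [|m IHm] n; first by rewrite ffactn0.
case: n => [|n]; first by rewrite ffact0n.
rewrite ffactSS expnS leq_mul2l /=; apply: leq_trans (IHm n) _.
by case: m {IHm} => // m; rewrite leq_exp2r.
Qed.

(** The falling factorial [(2m) ... (m + 1)] is at least [m^m] and equals [C(2m, m) m! <= 4^m m!].
    The bound absorbs the factor [m^m] when level sets of size [m] are summed over. *)
Lemma bin_pow_le (n m : nat) : ('C(n, m) * m ^ m <= (4 * n) ^ m)%N.
Proof.
have h1 : (m ^ m <= 4 ^ m * m`!)%N.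
  apply: (@leq_trans (m.*2 ^_ m)).
    suff H k a : (a <= m)%N -> (k <= a)%N -> (m ^ k <= (m + a) ^_ k)%N by rewrite -addnn; apply: H.
    elim: k a => [|k IHk] a am ka; first by rewrite ffactn0.
    case: a am ka => // a am ka; rewrite addnS ffactnS expnS leq_mul //; first by lia.
    by apply: IHk => //; lia.
  rewrite -bin_ffact leq_mul2r; apply/orP; right.
  have -> : (4 ^ m = 2 ^ m.*2)%N by rewrite -mul2n expnM.
  by have := card_draws 'I_m.*2 m; rewrite card_ord => <-; rewrite -card_sets max_card.
have h2 : ('C(n, m) * m`! <= n ^ m)%N by rewrite bin_ffact ffact_le_exp.
rewrite expnMn; apply: (@leq_trans ('C(n, m) * (4 ^ m * m`!))); first by rewrite leq_mul2l h1 orbT.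
by rewrite mulnCA leq_mul2l h2 orbT.
Qed.

Definition coord_proj (R : fieldType) {n : nat} (J : {set 'I_n}) : 'M[R]_n :=
  \matrix_(i, j) ((i == j) && (i \in J))%:R.

Lemma rank_coord_proj (R : fieldType) (n : nat) (J : {set 'I_n}) :
  (\rank (coord_proj R J) <= #|J|)%N.
Proof.
have -> : coord_proj R J =
    (\matrix_(i < n, k < #|J|) (i == enum_val k)%:R) *m rowsub enum_val (coord_proj R J).
  apply/matrixP => i j; rewrite !mxE.
  have [iJ|iJ] := boolP (i \in J); last first.
    rewrite andbF big1 // => k _; rewrite !mxE.
    case: eqP => [e|]; rewrite ?mul0r //.
    by case/negP: iJ; rewrite e enum_valP.
  rewrite (bigD1 (enum_rank_in iJ i)) //= big1 ?addr0 => [|k ki]; last first.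
    rewrite !mxE; case: eqP => [e|]; rewrite ?mul0r //.
    by case/eqP: ki; apply: enum_val_inj; rewrite enum_rankK_in.
  by rewrite !mxE enum_rankK_in // eqxx mul1r iJ.
exact: mulmx_max_rank.
Qed.

Lemma mul_coord_proj (R : fieldType) (n : nat) (J : {set 'I_n}) (a : 'rV[R]_n) (j : 'I_n) :
  (a *m coord_proj R J) 0 j = if j \in J then a 0 j else 0.
Proof.
rewrite !mxE (bigD1 j) //= big1 ?addr0 => [|i ij]; last first.
  by rewrite !mxE (negPf ij) mulr0.
by rewrite !mxE eqxx; case: ifP; rewrite ?mulr1 ?mulr0.
Qed.

(* Contains every a with |a_i| constant on I and N = {i in I | a_i < 0}; the value
   0 is allowed, so zero coordinates need no separate treatment. *)
Definition level_space (R : fieldType) {n : nat} (I N : {set 'I_n}) : 'M[R]_n :=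
  coord_proj R (~: I) +
  (\col_i (i \in I)%:R) *m
  (\row_j (if j \in I then if j \in N then -1 else 1 else 0)).

Lemma rank_level_space (R : fieldType) (n : nat) (I N : {set 'I_n}) :
  (\rank (level_space R I N) <= (n - #|I|).+1)%N.
Proof.
apply: leq_trans (mxrank_add _ _) _; rewrite -[leqRHS]addn1.
apply: leq_add; last exact: mulmx_max_rank.
apply: leq_trans (rank_coord_proj _ _ _) _.
by rewrite -[X in (X - _)%N](card_ord n) -(cardsC I) addKn.
Qed.

Lemma sub_level_space (R : realFieldType) (n : nat) (a : 'rV[R]_n) (I : {set 'I_n}) (c : R) :
    (0 < #|I|)%N -> {in I, forall i, `|a 0 i| = c} ->
  (a <= level_space R I [set i in I | (a 0 i < 0)%R])%MS.
Proof.
move=> I0 aI; set N := [set i in I | _].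
(* The entries of [b] on [I] add up to [c], the coefficient of the sign row of [level_space]; the
   coordinates outside [I] are copied by the projection. *)
pose b := \row_i (if i \in I then c / #|I|%:R else a 0 i).
suff -> : a = b *m level_space R I N by exact: submxMl.
apply/rowP => j; rewrite mulmxDr mxE mul_coord_proj mulmxA [X in _ + X]mxE big_ord1.
rewrite [X in X * _]mxE [X in _ * X]mxE.
have -> : \sum_i b 0 i * (\col_i0 (i0 \in I)%:R) i 0 = c.
  rewrite (bigID (mem I)) /= [X in _ + X]big1 ?addr0 => [|i iI]; last first.
    by rewrite !mxE (negPf iI) mulr0.
  rewrite (eq_bigr (fun=> c / #|I|%:R)) => [|i iI]; last by rewrite !mxE iI mulr1.
  by rewrite sumr_const -[LHS]mulr_natr mulfVK // pnatr_eq0 -lt0n.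
rewrite mxE !inE; have [jI|jI] := boolP (j \in I); last by rewrite mulr0 addr0.
rewrite /= add0r; case: ltP => sj.
  by rewrite mulrN1 -(aI j jI) ltr0_norm // opprK.
by rewrite mulr1 -(aI j jI) ger0_norm.
Qed.

(** The row tuples of singular sign matrices: [1%:M] stands for the whole space. *)
Definition singular (R : fieldType) (n : nat) : {set {ffun 'I_n -> {set 'I_n}}} :=
  orth_tuples R (fun a => a != 0) n 1%:M.

Definition spread {R : realFieldType} {n : nat} (s m : nat) (a : 'rV[R]_n) : Prop :=
  (s < #|[set j | (a 0 j != 0)%R]|)%N /\
  forall c : R, 0 < c -> (#|[set j | (`|a 0 j| == c)%R]| <= m)%N.

Lemma spread_neq0 (R : realFieldType) (n s m : nat) (a : 'rV[R]_n) : spread s m a -> a != 0.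
Proof.
case=> + _; apply: contraTneq => ->; rewrite -leqNgt.
by rewrite eq_card0 // => j; rewrite !inE mxE eqxx.
Qed.

Lemma spread_atom (R : rcfType) (n s m : nat) (a : 'rV[R]_n) : spread s m a ->
  #|[set S | dotS S a == 0]|%:R <=
    (m%:R * (12 / (s.+1%:R * Num.sqrt s.+1%:R))) * 2 ^+ n :> R.
Proof.
case=> st lev; have s0 := leq_trans (ltn0Sn s) st.
apply: le_trans (@atom_bound R n m a s0 lev) _.
rewrite ler_wpM2r ?exprn_ge0 // mulrA [m%:R * _]mulrC ler_wpM2l ?mulr_ge0 //.
have p k : (0 < k)%N -> 0 < k%:R * Num.sqrt k%:R :> R.
  by move=> k0; rewrite mulr_gt0 ?sqrtr_gt0 ?ltr0n.
by rewrite lef_pV2 ?posrE ?p // ler_pM ?sqrtr_ge0 ?ler_wsqrtr ?ler_nat.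
Qed.

(** The cases for a kernel vector: at most [s] nonzero coordinates; otherwise all classes of
    coordinates of equal absolute value have at most 2 elements; otherwise [IN.1] is a largest class
    and [IN.2] its negative part. *)
Lemma singular_cover (R : rcfType) (n s : nat) (F : {ffun 'I_n -> {set 'I_n}}) :
    (s <= n)%N -> F \in singular R n ->
  [\/ exists2 J : {set 'I_n}, #|J| == s &
        F \in orth_tuples R (fun a => a != 0) n (coord_proj R J),
      F \in orth_tuples R (spread s 2) n 1%:M |
      exists2 IN : {set 'I_n} * {set 'I_n}, (2 < #|IN.1|)%N && (IN.2 \subset IN.1) &
        F \in orth_tuples R (spread s #|IN.1|) n (level_space R IN.1 IN.2)].
Proof.
move=> sn; rewrite inE => /asboolP[a [a0 _ oa]].
have [st|st] := leqP #|[set j | a 0 j != 0]| s.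
  apply: Or31; set Z := [set j | _] in st.
  (* The support is padded to exactly [s] elements, so that a single binomial coefficient counts the
     choices. *)
  have [J ZJ cJ] : exists2 J : {set 'I_n}, Z \subset J & #|J| = s.
    have: (s - #|Z| <= #|~: Z|)%N by have := cardsC Z; rewrite card_ord; lia.
    move=> /card_geqP[q [uq sq qZ]].
    exists (Z :|: [set x in q]); first exact: subsetUl.
    have cq : #|[set x in q]| = (s - #|Z|)%N by rewrite cardsE (card_uniqP uq).
    have e0 : Z :&: [set x in q] = set0.
      apply/setP => x; rewrite in_setI in_set0; apply/negP => /andP[xZ].
      by rewrite inE => /qZ; rewrite inE xZ.
    by rewrite cardsU cq e0 cards0 subn0 subnKC.
  exists J; first by rewrite cJ.
  rewrite inE; apply/asboolP; exists a; split => //.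
  suff -> : a = a *m coord_proj R J by exact: submxMl.
  apply/rowP => j; rewrite mul_coord_proj; case: ifP => // jJ; apply/eqP.
  apply: contraFT jJ => aj; apply: (subsetP ZJ); by rewrite inE.
pose lv j := [set i | `|a 0 i| == `|a 0 j|].
have [j0 _] : exists j, j \in [set j | a 0 j != 0].
  by apply/set0Pn; rewrite -card_gt0; lia.
(* The maximum is over all coordinates, so the largest class may be that of the zeros. *)
have [j _ jmax] := @arg_maxnP _ j0 predT (fun j => #|lv j|) isT.
have sp : spread s #|lv j| a.
  split => // c c0; have [->|/set0Pn[i]] := eqVneq [set i | `|a 0 i| == c] set0.
    by rewrite cards0.
  rewrite inE => /eqP <-; exact: (jmax i isT).
have [l2|l2] := leqP #|lv j| 2.
  apply: Or32; rewrite inE; apply/asboolP; exists a; split => //; last exact: submx1.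
  by split => // c c0; apply: leq_trans l2; case: sp => _; exact.
apply: Or33; exists (lv j, [set i in lv j | a 0 i < 0]) => /=.
  by rewrite l2; apply/subsetP => i; rewrite inE => /andP[].
rewrite inE; apply/asboolP; exists a; split => //.
apply: (@sub_level_space R n a (lv j) `|a 0 j|); first exact: leq_trans l2.
by move=> i; rewrite inE => /eqP.
Qed.

Lemma expr_quot_le (R : realFieldType) (x : R) (k r m : nat) :
  0 < x <= 1 -> (r + m <= k)%N -> x ^+ k / x ^+ r <= x ^+ m.
Proof.
move=> /andP[x0 x1] le; rewrite ler_pdivrMr ?exprn_gt0 // -exprD.
by apply: ler_wiXn2l; rewrite ?x1 ?ltW // addnC.
Qed.

Lemma geom_tail (R : realFieldType) (u : R) (N : nat) :
  0 <= u <= 1 / 2 -> \sum_(m < N | (2 < m)%N) u ^+ m <= 2 * u ^+ 3.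
Proof.
move=> /andP[u0 u1].
suff: \sum_(m < N | (2 < m)%N) u ^+ m <= 2 * u ^+ 3 - 2 * u ^+ maxn N 3.
  by have : 0 <= u ^+ maxn N 3 by [rewrite exprn_ge0]; lra.
elim: N => [|N IHN]; first by rewrite big_ord0 max0n subrr.
rewrite big_mkcond big_ord_recr -big_mkcond /=; case: ltnP => hN; last first.
  by rewrite addr0; move: IHN; rewrite !(maxn_idPr _) // ltnW.
move: IHN; rewrite !(maxn_idPl _) //; last exact: ltnW.
have : 0 <= u ^+ N * (1 / 2 - u) by rewrite mulr_ge0 ?exprn_ge0 // subr_ge0.
by rewrite [u ^+ N.+1]exprS; lra.
Qed.

Lemma sum_subset_pairs (R : pzRingType) (n : nat) (g : nat -> R) (P : pred nat) :
  \sum_(IN : {set 'I_n} * {set 'I_n} | P #|IN.1| && (IN.2 \subset IN.1)) g #|IN.1| =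
  \sum_(m < n.+1 | P m) ('C(n, m) * 2 ^ m)%:R * g m.
Proof.
rewrite -(pair_big_dep (fun I : {set 'I_n} => P #|I|) (fun I N : {set 'I_n} => N \subset I)
  (fun I _ => g #|I|)) /=.
rewrite (eq_bigr (fun I : {set 'I_n} => (2 ^ #|I|)%:R * g #|I|)) => [|I _]; last first.
  rewrite (eq_bigl (mem (powerset I))) => [|N]; last by rewrite /= inE.
  by rewrite sumr_const card_powerset mulr_natl.
have cI (I : {set 'I_n}) : (#|I| < n.+1)%N.
  by rewrite ltnS -[leqRHS]card_ord max_card.
rewrite (partition_big (fun I => Ordinal (cI I)) (fun m => P m)) //=.
apply: eq_bigr => m Pm.
rewrite (eq_bigl (mem [set I : {set 'I_n} | #|I| == m])) => [|I]; last first.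
  rewrite /= inE; apply/andP/eqP => [[_ /eqP <-]//|Im]; split; first by rewrite Im.
  by apply/eqP/val_inj.
rewrite (eq_bigr (fun=> (2 ^ m)%:R * g m)) => [|I]; last by rewrite /= inE => /eqP ->.
by rewrite sumr_const card_draws card_ord -[LHS]mulr_natl natrM mulrA.
Qed.

(** One summand for each class of [singular_cover]. For levels of size at most [m] the atom
    probability is at most [m r], which makes [m y] the ratio in [card_orth_tuples_atom]. *)
Lemma card_singular_le (R : rcfType) (n s l : nat) :
    let r : R := 12 / (s.+1%:R * Num.sqrt s.+1%:R) in
    let y := 2 * l.+1%:R * r in
    (0 < n)%N -> (s <= n)%N -> 2 ^- l <= r -> 16 * n%:R * y <= 1 ->
  #|singular R n|%:R <= ('C(n, s)%:R * (4 * (2 / 3) ^+ (n.+1 - s)) + 8 * y +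
     8 * (8 * n%:R * y) ^+ 3) * 2 ^+ (n * n) :> R.
Proof.
move=> r y n0 sn hl hy.
have r0 : 0 < r by apply: lt_le_trans hl; rewrite invr_gt0 exprn_gt0.
have y0 : 0 < y by apply: mulr_gt0 r0; rewrite -natrM ltr0n.
have n1 : 1 <= n%:R :> R by rewrite ler1n.
have ny : n%:R * y <= 1 / 16 by lra.
have y1 : y <= 1 / 16 by apply: le_trans ny; rewrite ler_peMl // ltW.
pose Q : R := 2 ^+ (n * n); have Q0 : 0 <= Q by rewrite exprn_ge0.
pose A (J : {set 'I_n}) := orth_tuples R (fun a => a != 0) n (coord_proj R J).
pose B := orth_tuples R (spread s 2) n (1%:M : 'M[R]_n).
pose E (IN : {set 'I_n} * {set 'I_n}) :=
  orth_tuples R (spread s #|IN.1|) n (level_space R IN.1 IN.2).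
have atom m (D : 'M[R]_n) : (0 < m)%N -> m%:R * y <= 1 ->
    #|orth_tuples R (spread s m) n D|%:R <=
      4 * (m%:R * y) ^+ n.+1 / (m%:R * y) ^+ \rank D * Q.
  move=> m0 my; have e : m%:R * y = 2 * l.+1%:R * (m%:R * r) by rewrite mulrCA.
  rewrite e; apply: card_orth_tuples_atom; rewrite -?e //.
  - by move=> a; exact: spread_neq0.
  - by move=> a; exact: spread_atom.
  - by apply: le_trans hl _; rewrite ler_peMl ?ler1n // ltW.
pose X1 := [set F in singular R n | [exists J : {set 'I_n}, (#|J| == s) && (F \in A J)]].
pose X3 := [set F in singular R n | [exists IN : {set 'I_n} * {set 'I_n},
    (2 < #|IN.1|)%N && (IN.2 \subset IN.1) && (F \in E IN)]].
have sub : singular R n \subset X1 :|: B :|: X3.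
  apply/subsetP => F FS; rewrite !in_setU.
  have [[J Js FJ]|FB|[IN IN2 FE]] := @singular_cover R n s F sn FS.
  - rewrite [F \in X1]inE FS (_ : [exists J, _] = true) //.
    by apply/existsP; exists J; rewrite Js.
  - by rewrite [F \in B]FB orbT.
  - rewrite [F \in X3]inE FS (_ : [exists IN, _] = true) ?orbT //.
    by apply/existsP; exists IN; rewrite IN2.
have cS : #|singular R n|%:R <= #|X1|%:R + #|B|%:R + #|X3|%:R :> R.
  rewrite -!natrD ler_nat; apply: leq_trans (subset_leq_card sub) _.
  by apply: leq_trans (leq_card_setU _ _) _; rewrite leq_add2r leq_card_setU.
have c1 : #|X1|%:R <= 'C(n, s)%:R * (4 * (2 / 3) ^+ (n.+1 - s)) * Q.
  apply: (@le_trans _ _ (\sum_(J : {set 'I_n} | #|J| == s) #|A J|%:R)).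
    rewrite -natr_sum ler_nat; apply: card_cover => F; rewrite inE.
    by case/andP => _ /existsP[J /andP[Js FJ]]; exists J.
  apply: (@le_trans _ _ (\sum_(J : {set 'I_n} | #|J| == s) 4 * (2 / 3) ^+ (n.+1 - s) * Q)).
    apply: ler_sum => J /eqP cJ; apply: le_trans (@card_orth_tuples_small R n n _) _.
    rewrite ler_wpM2r // -mulrA ler_pM2l //; apply: expr_quot_le; first lra.
    have := rank_coord_proj R n J; rewrite cJ => h.
    by apply: leq_trans (leq_add h (leqnn _)) _; rewrite subnKC // leqW.
  rewrite (eq_bigl (mem [set J : {set 'I_n} | #|J| == s])) => [|J]; last by rewrite /= inE.
  by rewrite sumr_const card_draws card_ord -[leLHS]mulr_natl mulrA.
have c2 : #|B|%:R <= 8 * y * Q.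
  apply: le_trans (atom 2%N 1%:M _ _) _ => //; first by rewrite /=; lra.
  rewrite mxrank1 ler_wpM2r // exprS mulrA mulfK; first by lra.
  by rewrite gt_eqF // exprn_gt0 // mulr_gt0.
have c3 : #|X3|%:R <= 8 * (8 * n%:R * y) ^+ 3 * Q.
  apply: (@le_trans _ _ (\sum_(IN : {set 'I_n} * {set 'I_n} |
      (2 < #|IN.1|)%N && (IN.2 \subset IN.1)) #|E IN|%:R)).
    rewrite -natr_sum ler_nat; apply: card_cover => F; rewrite inE.
    by case/andP => _ /existsP[IN /andP[IN2 FE]]; exists IN.
  apply: (@le_trans _ _ (\sum_(IN : {set 'I_n} * {set 'I_n} |
      (2 < #|IN.1|)%N && (IN.2 \subset IN.1)) 4 * (#|IN.1|%:R * y) ^+ #|IN.1| * Q)).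
    apply: ler_sum => -[I N] /= /andP[I2 NI].
    have In : (#|I| <= n)%N by rewrite -[leqRHS]card_ord max_card.
    have I0 : (0 < #|I|)%N by exact: leq_trans I2.
    have Iy : #|I|%:R * y <= 1.
      by apply: (@le_trans _ _ (n%:R * y)); [rewrite ler_pM2r // ler_nat | lra].
    apply: le_trans (atom _ _ I0 Iy) _; rewrite ler_wpM2r // -mulrA ler_pM2l //.
    (* The rank is at most [n - #|I| + 1], so of the exponent [n + 1] there remains [#|I|]. *)
    apply: expr_quot_le; first by rewrite Iy andbT mulr_gt0 // ltr0n.
    have := leq_add (rank_level_space R n I N) (leqnn #|I|).
    by rewrite addSn subnK.
  rewrite (@sum_subset_pairs R n (fun m => 4 * (m%:R * y) ^+ m * Q) (fun m => 2 < m)%N).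
  apply: (@le_trans _ _ (\sum_(m < n.+1 | (2 < m)%N) (8 * n%:R * y) ^+ m * (4 * Q))).
    apply: ler_sum => m _.
    (* [bin_pow_le] gives [(4 n)^m], and the [2^m] choices of the negative part double the base. *)
    have key : 'C(n, m)%:R * 2 ^+ m * (m%:R * y) ^+ m <= (8 * n%:R * y) ^+ m.
      have -> : 8 * n%:R * y = 4 * n%:R * (2 * y) by ring.
      rewrite [(m%:R * y) ^+ m]exprMn mulrACA -[2 ^+ m * y ^+ m]exprMn [leRHS]exprMn.
      have y2 : 0 <= 2 * y by lra.
      rewrite ler_wpM2r ?exprn_ge0 //.
      by have := bin_pow_le n m; rewrite -(ler_nat R) !(natrM, natrX).
    have Q4 : 0 <= 4 * Q by rewrite mulr_ge0.
    have := ler_wpM2r Q4 key; rewrite natrM natrX -!mulrA.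
    by rewrite [4 * ((m%:R * y) ^+ m * Q)]mulrCA.
  rewrite -mulr_suml.
  have u0 : 0 <= 8 * n%:R * y <= 1 / 2.
    by apply/andP; split; last lra; have := mulr_ge0 (ler0n R n) (ltW y0); lra.
  have Q4 : 0 <= 4 * Q by rewrite mulr_ge0.
  have := ler_wpM2r Q4 (@geom_tail R _ n.+1 u0); lra.
rewrite 2!mulrDl; apply: le_trans cS _; apply: lerD c3; exact: lerD c1 c2.
Qed.

(** * Minimal balanced collections as linearly independent tuples *)

Lemma charvec_sumP (R : realType) (n : nat) (I : finType) (P : pred I)
    (S : I -> {set 'I_n}) (w : I -> R) (c : R) :
  \sum_(i | P i) w i *: char_vec R (S i) = const_mx c <->
  forall j, \sum_(i | P i) w i * (j \in S i)%:R = c.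
Proof.
split=> [/matrixP e j | e].
  by have := e j 0; rewrite !mxE summxE => <-; apply: eq_bigr => i _; rewrite !mxE.
apply/matrixP => j k; rewrite !mxE summxE -[RHS](e j).
by apply: eq_bigr => i _; rewrite !mxE.
Qed.

Definition indep_tuple (R : realType) {n k : nat} (F : {ffun 'I_k -> {set 'I_n}}) : Prop :=
  forall nu : 'I_k -> R,
    (forall j, \sum_i nu i * (j \in F i)%:R = 0) -> forall i, nu i = 0.

(** Given a nontrivial relation, move the weights along it until the first of them vanishes: the
    sets with positive weight left form a balanced proper subcollection. Applying this to [nu] and
    to [- nu] excludes both signs. *)
Lemma minimal_balanced_indep (R : realType) (n : nat) (Phi : {set {set 'I_n}})
    (nu : {set 'I_n} -> R) :
    minimal_balanced R Phi -> (forall j, \sum_(S in Phi) nu S * (j \in S)%:R = 0) ->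
  {in Phi, forall S, nu S = 0}.
Proof.
move=> [[lam [lam0 /charvec_sumP lam1]] minP].
have half (mu : {set 'I_n} -> R) : (forall j, \sum_(S in Phi) mu S * (j \in S)%:R = 0) ->
    {in Phi, forall S, mu S <= 0}.
  move=> mu0 S SPhi; rewrite leNgt; apply/negP => muS.
  pose Q := [set T in Phi | 0 < mu T].
  have SQ : S \in Q by rewrite inE SPhi.
  have [T TQ Tmin] := @arg_minP _ _ _ S (mem Q) (fun T => lam T / mu T) SQ.
  have : T \in Q := TQ; rewrite inE => /andP[TPhi muT].
  set t := lam T / mu T in Tmin.
  have t0 : 0 < t by rewrite divr_gt0 ?lam0.
  have ge0 U : U \in Phi -> 0 <= lam U - t * mu U.
    move=> UPhi; have [muU|muU] := ltP 0 (mu U); last first.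
      rewrite subr_ge0; apply: le_trans (_ : 0 <= _); last exact/ltW/lam0.
      by rewrite pmulr_rle0.
    have UQ : U \in Q by rewrite inE UPhi.
    by have : t <= lam U / mu U := Tmin U UQ; rewrite ler_pdivlMr // subr_ge0.
  pose Psi := [set U in Phi | 0 < lam U - t * mu U].
  apply: (minP Psi).
    rewrite properE; apply/andP; split; first by apply/subsetP => U; rewrite inE => /andP[].
    apply/subsetPn; exists T => //.
    by rewrite inE TPhi /= /t divfK ?gt_eqF // subrr ltxx.
  exists (fun U => lam U - t * mu U); split; first by move=> U; rewrite inE => /andP[].
  apply/charvec_sumP => j.
  transitivity (\sum_(U in Phi) (lam U - t * mu U) * (j \in U)%:R); last first.
    under eq_bigr do rewrite mulrBl -mulrA.
    by rewrite sumrB -mulr_sumr mu0 lam1 mulr0 subr0.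
  rewrite [RHS](bigID (fun U => 0 < lam U - t * mu U)) /= [X in _ = _ + X]big1 ?addr0.
    by apply: eq_bigl => U; rewrite inE.
  move=> U /andP[UPhi]; rewrite -leNgt => le0.
  have -> : lam U - t * mu U = 0 by apply/eqP; rewrite eq_le le0 ge0.
  by rewrite mul0r.
move=> nu0 S SPhi; apply/eqP; rewrite eq_le (half nu nu0) //=.
rewrite -oppr_le0; apply: (half (fun S => - nu S)) => // j.
under eq_bigr do rewrite mulNr.
by rewrite sumrN nu0 oppr0.
Qed.

(** Ordered collections are easier to complement and to count; each collection of [k] members
    appears [k!] times. *)
Definition good_tuples (R : realType) (n k : nat) : {set {ffun 'I_k -> {set 'I_n}}} :=
  [set F : {ffun 'I_k -> {set 'I_n}} |
    injectiveb F && `[< minimal_balanced R [set F i | i : 'I_k] >]].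

(** Independence makes the weights unique; as they are all positive, no proper subcollection can be
    balanced. The converse is [minimal_balanced_indep]. *)
Lemma good_tuplesP (R : realType) (n k : nat) (F : {ffun 'I_k -> {set 'I_n}}) :
  F \in good_tuples R n k <->
  exists lam : 'I_k -> R, [/\ forall i, 0 < lam i,
    forall j, \sum_i lam i * (j \in F i)%:R = 1 & indep_tuple R F].
Proof.
have sumF (g : {set 'I_n} -> R) : injective F ->
    \sum_(S in [set F i | i : 'I_k]) g S = \sum_i g (F i).
  move=> inj; rewrite big_imset /=; last by move=> x y _ _; exact: inj.
  by apply: eq_bigl => i; rewrite inE.
split.
  rewrite inE => /andP[/injectiveP inj /asboolP mb].
  have [[lam [lam0 /charvec_sumP lam1]] _] := mb.
  exists (fun i => lam (F i)); split.
  - by move=> i; apply: lam0; apply: imset_f.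
  - by move=> j; rewrite -[RHS](lam1 j) (sumF (fun S => lam S * (j \in S)%:R)).
  - move=> nu nu0 i.
    pose mu S := \sum_(i | F i == S) nu i.
    have muF l : mu (F l) = nu l.
      by rewrite /mu (big_pred1 l) // => l'; rewrite /= (inj_eq inj).
    rewrite -muF; apply: (minimal_balanced_indep _ _ _ mu mb); last exact: imset_f.
    move=> j; rewrite (sumF (fun S => mu S * (j \in S)%:R)) // -[RHS](nu0 j).
    by apply: eq_bigr => l _; rewrite muF.
move=> [lam [lam0 lam1 ind]].
have inj : injective F.
  move=> i i' e; apply/eqP/negPn/negP => ne.
  pose nu l : R := (l == i)%:R - (l == i')%:R.
  have : nu i = 0.
    apply: ind => j; rewrite (bigD1 i) //= (bigD1 i') 1?eq_sym //=.
    rewrite big1 ?addr0 => [|l /andP[li li']]; last by rewrite /nu (negPf li) (negPf li') subrr mul0r.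
    by rewrite /nu !eqxx (negPf ne) [i' == i]eq_sym (negPf ne) e subr0 sub0r mul1r mulN1r subrr.
  by rewrite /nu eqxx (negPf ne) subr0 => /eqP; rewrite oner_eq0.
rewrite inE; apply/andP; split; first exact/injectiveP.
apply/asboolP; split.
  pose mu S := \sum_(i | F i == S) lam i.
  have muF l : mu (F l) = lam l.
    by rewrite /mu (big_pred1 l) // => l'; rewrite /= (inj_eq inj).
  exists mu; split; first by move=> S /imsetP[i _ ->]; rewrite muF.
  apply/charvec_sumP => j; rewrite (sumF (fun S => mu S * (j \in S)%:R)) // -[RHS](lam1 j).
  by apply: eq_bigr => l _; rewrite muF.
move=> Psi /properP[sub [S /imsetP[i _ ->] nPsi]] [mu [mu0 /charvec_sumP mu1]].
(* The difference of the two weightings, the second extended by 0; at the missing set [F i] it is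
   [lam i], which is positive. *)
pose nu l := lam l - (if F l \in Psi then mu (F l) else 0).
have : nu i = 0.
  apply: ind => j; under eq_bigr do rewrite mulrBl.
  rewrite sumrB lam1 -[X in X - _](mu1 j).
  rewrite -(sumF (fun S => (if S \in Psi then mu S else 0) * (j \in S)%:R)) //.
  rewrite [X in _ - X](bigID (mem Psi)) /= [X in _ - (_ + X)]big1 ?addr0; last first.
    by move=> T /andP[_ /negPf ->]; rewrite mul0r.
  apply/eqP; rewrite subr_eq0; apply/eqP; apply: eq_big => [T|T TPsi]; last by rewrite TPsi.
  by apply/idP/andP => [TP|[]//]; split=> //; apply: (subsetP sub).
by rewrite /nu (negPf nPsi) subr0 => e; move: (lam0 i); rewrite e ltxx.
Qed.

(** * Complementing members of a tuple *)

Definition flip {n k : nat} (B : {set 'I_k}) (F : {ffun 'I_k -> {set 'I_n}}) :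
    {ffun 'I_k -> {set 'I_n}} :=
  [ffun i => if i \in B then ~: F i else F i].

Lemma flip_symd (n k : nat) (B C : {set 'I_k}) (F : {ffun 'I_k -> {set 'I_n}}) :
  flip B (flip C F) = flip (symd B C) F.
Proof.
apply/ffunP => i; rewrite !ffunE !inE.
by case: (i \in B); case: (i \in C); rewrite //= setCK.
Qed.

Lemma flipK (n k : nat) (B : {set 'I_k}) : involutive (@flip n k B).
Proof.
move=> F; rewrite flip_symd; apply/ffunP => i; rewrite ffunE inE addbb.
by [].
Qed.

(** Rewritten in terms of [F], the weights [mu] of the flipped tuple give [d] times the all-one
    vector, with coefficients negative exactly on [B]. By independence they equal [d * lam], so they
    all have one sign, and [B] is empty or everything. *)
Lemma good_flip (R : realType) (n k : nat) (B : {set 'I_k})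
    (F : {ffun 'I_k -> {set 'I_n}}) (i i' : 'I_k) :
    F \in good_tuples R n k -> flip B F \in good_tuples R n k ->
  i \in B -> i' \in B.
Proof.
move=> /good_tuplesP[lam [lam0 lam1 ind]] /good_tuplesP[mu [mu0 mu1 _]] iB.
apply/negPn/negP => i'B.
pose e l : R := if l \in B then -1 else 1.
pose d : R := 1 - \sum_(l in B) mu l.
have key l : e l * mu l - d * lam l = 0.
  move: l; apply: (ind (fun l => e l * mu l - d * lam l)) => j.
  under eq_bigr do rewrite mulrBl -[d * _ * _]mulrA.
  rewrite sumrB -mulr_sumr lam1 mulr1 /d -[X in _ - (X - _)](mu1 j).
  rewrite [\sum_(l in B) mu l]big_mkcond -sumrB; apply/eqP; rewrite subr_eq0; apply/eqP.
  apply: eq_bigr => l _; rewrite ffunE /e; case: (l \in B); rewrite ?inE ?mul1r ?subr0 //.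
  by case: (j \in F l) => /=; rewrite !(mulr0, mulr1, sub0r, subrr, mulN1r, oppr0).
have := key i; have := key i'; rewrite /e iB (negPf i'B) mul1r mulN1r => k1 k2.
have d0 : 0 < d.
  have : 0 < d * lam i' by have := mu0 i'; lra.
  by rewrite pmulr_lgt0.
by have := mulr_gt0 d0 (lam0 i); have := mu0 i; lra.
Qed.

Lemma card_ffun_sets (n k : nat) : #|{: {ffun 'I_k -> {set 'I_n}}}| = (2 ^ (n * k))%N.
Proof. by rewrite card_ffun card_sets card_ord expnM. Qed.

(** The sets without [ord0] represent the flips up to an overall complementation. *)
Lemma card_avoid0 (k : nat) : #|powerset (~: [set (ord0 : 'I_k.+1)])| = (2 ^ k)%N.
Proof.
by rewrite card_powerset; congr expn; have := cardsC1 (ord0 : 'I_k.+1); rewrite card_ord.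
Qed.

(** Flipping good tuples by sets without [ord0] is injective: two good tuples with a common image
    differ by a flip that spares [ord0], which [good_flip] makes trivial. *)
Lemma card_good_le (R : realType) (n k : nat) :
  (#|good_tuples R n k.+1| * 2 ^ k <= 2 ^ (n * k.+1))%N.
Proof.
rewrite -card_ffun_sets -card_avoid0 -cardsX.
rewrite -(card_in_imset (f := fun p : {ffun _} * {set _} => flip p.2 p.1)) ?max_card //.
move=> [F B] [G C] /setXP[/= Fg B0] /setXP[/= Gg C0] /= e.
rewrite !powersetE in B0 C0.
have eG : G = flip (symd C B) F by rewrite -flip_symd e flipK.
have sub x : x \in symd C B -> false.
  move=> xS; have : ord0 \in symd C B.
    have fg : flip (symd C B) F \in good_tuples R n k.+1 by rewrite -eG.
    exact: (@good_flip R n k.+1 (symd C B) F x ord0 Fg fg xS).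
  rewrite inE => h; have /subsetP/(_ ord0) := B0; have /subsetP/(_ ord0) := C0.
  rewrite !inE eqxx; move: h; case: (ord0 \in C); case: (ord0 \in B) => //= _.
  - by move=> /(_ isT).
  - by move=> _ /(_ isT).
have CB : C = B.
  apply/setP => x; have := sub x; rewrite inE.
  by case: (x \in C); case: (x \in B) => //= /(_ isT).
have -> : F = G; last by rewrite CB.
by move: e; rewrite CB => /(congr1 (flip B)); rewrite !flipK.
Qed.

(** * Generic tuples *)

Definition sg (R : pzRingType) {n : nat} (S : {set 'I_n}) (j : 'I_n) : R :=
  if j \in S then 1 else -1.

Lemma sgE (R : pzRingType) (n : nat) (S : {set 'I_n}) (j : 'I_n) :
  sg R S j = 2 * (j \in S)%:R - 1.
Proof.
rewrite /sg; case: (j \in S); first by rewrite mulr1 -addrA subrr addr0.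
by rewrite mulr0 sub0r.
Qed.

(** In a relation between the sign vectors and the all-one vector, of coefficient [c], either all
    [mu i] vanish or none does. *)
Definition generic (R : realType) {n k : nat} (F : {ffun 'I_k -> {set 'I_n}}) : Prop :=
  forall (mu : 'I_k -> R) (c : R), (forall j, \sum_i mu i * sg R (F i) j = c) ->
    (exists i, mu i = 0) -> forall i, mu i = 0.

(** The flip turns the coefficients into [|mu i|], and [1_S = (v_S + 1) / 2] turns the relation into
    weights with constant sum [d]. By genericity the relation is unique up to a factor, whence
    independence. *)
Lemma generic_flip_good (R : realType) (n k : nat) (F : {ffun 'I_k -> {set 'I_n}})
    (mu : 'I_k -> R) (c : R) :
    (0 < n)%N -> (1 < k)%N -> generic R F -> (forall i, mu i != 0) ->
    (forall j, \sum_i mu i * sg R (F i) j = c) ->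
  flip [set i | mu i < 0] F \in good_tuples R n k.
Proof.
move=> n0 k1 gen mu0 mue; set B := [set i | _]; set G := flip B F.
pose e l : R := if l \in B then -1 else 1.
have ee l : e l * e l = 1 by rewrite /e; case: ifP; rewrite ?mulrNN mulr1.
have sgG l j : sg R (G l) j = e l * sg R (F l) j.
  rewrite /sg /e ffunE; case: (l \in B); rewrite ?inE ?mul1r //.
  by case: (j \in F l); rewrite /= ?mulr1 // mulrNN mulr1.
have emu l : `|mu l| = e l * mu l.
  rewrite /e inE; case: ltP => s; first by rewrite ltr0_norm // mulN1r.
  by rewrite ger0_norm // mul1r.
have abs0 l : 0 < `|mu l| by rewrite normr_gt0.
have absG j : \sum_i `|mu i| * sg R (G i) j = c.
  rewrite -(mue j); apply: eq_bigr => l _; rewrite emu sgG.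
  by rewrite mulrACA ee mul1r.
pose d := (c + \sum_i `|mu i|) / 2.
have dG j : \sum_i `|mu i| * (j \in G i)%:R = d.
  rewrite /d -(absG j) -big_split /= mulr_suml; apply: eq_bigr => l _.
  by rewrite sgE; lra.
have d0 : 0 < d.
  have dge : 0 <= d.
    by rewrite -(dG (Ordinal n0)); apply: sumr_ge0 => l _; rewrite mulr_ge0.
  rewrite lt_neqAle dge andbT eq_sym; apply/negP => /eqP dz.
  (* If [d = 0], all sets of [G] are empty, so the sign vector of [F i0] is constant by itself. This
     is a relation with coefficient 0 at [i1], against genericity. *)
  have Gempty l j : (j \in G l) = false.
    apply/negP => jl; have := dG j; rewrite dz => /eqP.
    rewrite psumr_eq0 => [|i _]; last by rewrite mulr_ge0.
    move=> /allP/(_ l (mem_index_enum _)) /=; rewrite jl mulr1 => /eqP h.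
    by have := abs0 l; rewrite h ltxx.
  have k0 : (0 < k)%N by exact: ltnW.
  pose i0 := Ordinal k0; pose i1 := Ordinal k1.
  have := gen (fun l => if l == i0 then 1 else 0) (- e i0) _ _ i0; rewrite eqxx.
  move=> h; have : (1 : R) = 0.
    apply: h; last by exists i1.
    move=> j; rewrite (bigD1 i0) //= big1 ?addr0 => [|l /negPf ->]; last by rewrite mul0r.
    by rewrite ?eqxx mul1r -[LHS]mul1r -(ee i0) -mulrA -sgG /sg Gempty mulrN1.
  by move/eqP; rewrite oner_eq0.
apply/good_tuplesP; exists (fun i => `|mu i| / d); split.
- by move=> i; rewrite divr_gt0.
- move=> j; under eq_bigr do rewrite mulrAC.
  by rewrite -mulr_suml dG divff // gt_eqF.
move=> nu nuG i.
have nuF j : \sum_l (nu l * e l) * sg R (F l) j = - \sum_l nu l.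
  under eq_bigr do rewrite -mulrA -sgG sgE mulrBr mulr1 mulrCA.
  by rewrite sumrB -mulr_sumr nuG mulr0 sub0r.
(* With this factor the combined relation vanishes at [i], hence everywhere. *)
pose ka := nu i * e i / mu i.
have prop l : nu l * e l - ka * mu l = 0.
  apply: (gen (fun l => nu l * e l - ka * mu l) (- (\sum_l nu l) - ka * c)).
    move=> j; under eq_bigr do rewrite mulrBl -[ka * _ * _]mulrA.
    by rewrite sumrB -mulr_sumr nuF mue.
  by exists i; rewrite /ka mulfVK // subrr.
have nuE l : nu l = ka * `|mu l|.
  have /eqP := prop l; rewrite subr_eq0 => /eqP h.
  by rewrite emu mulrCA -h mulrCA ee mulr1.
have ka0 : ka * d = 0.
  rewrite -(dG (Ordinal n0)) mulr_sumr -[RHS](nuG (Ordinal n0)).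
  by apply: eq_bigr => l _; rewrite nuE mulrA.
by move/eqP: ka0; rewrite mulf_eq0 (gt_eqF d0) orbF nuE => /eqP ->; rewrite mul0r.
Qed.

(** A nonzero relation exists: a kernel vector if the sign matrix is singular, otherwise the
    solution for the all-one vector. *)
Lemma generic_good (R : realType) (n : nat) (F : {ffun 'I_n.+2 -> {set 'I_n.+2}}) :
    generic R F ->
  exists2 B : {set 'I_n.+2}, ord0 \notin B & flip B F \in good_tuples R n.+2 n.+2.
Proof.
move=> gen; pose V : 'M[R]_n.+2 := \matrix_(i, j) sg R (F i) j.
have [u u0 [c uc]] : exists2 u : 'rV[R]_n.+2, u != 0 & exists c, u *m V = const_mx c.
  have [/det0P[u u0 uV]|dV] := boolP (\det V == 0).
    by exists u => //; exists 0; rewrite uV; apply/matrixP => i j; rewrite !mxE.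
  have Vu : V \in unitmx by rewrite unitmxE unitfE.
  exists (const_mx 1 *m invmx V); last by exists 1; rewrite mulmxKV.
  apply/eqP => /(congr1 (mulmx^~ V)); rewrite mulmxKV // mul0mx.
  by move/matrixP/(_ 0 0)/eqP; rewrite !mxE oner_eq0.
have sol j : \sum_i u 0 i * sg R (F i) j = c.
  by move/matrixP/(_ 0 j): uc; rewrite !mxE => <-; apply: eq_bigr => i _; rewrite mxE.
have un0 i : u 0 i != 0.
  apply/eqP => ui; case/eqP: u0; apply/rowP => l; rewrite mxE.
  by apply: (gen (fun i => u 0 i) c) => //; exists i.
have g1 := generic_flip_good R _ _ F (fun i => u 0 i) c isT isT gen un0 sol.
(* The opposite relation flips the complementary set, and one of the two sets avoids [ord0]. *)
have [h|h] := boolP (ord0 \in [set i | u 0 i < 0]); last by exists [set i | u 0 i < 0].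
exists [set i | - u 0 i < 0]; first by move: h; rewrite !inE oppr_lt0 -leNgt => /ltW.
apply: (generic_flip_good R _ _ F (fun i => - u 0 i) (- c)) => //.
  by move=> i; rewrite oppr_eq0.
by move=> j; under eq_bigr do rewrite mulNr; rewrite sumrN sol.
Qed.

Lemma card_generic_le (R : realType) (n : nat) :
  (#|[set F : {ffun 'I_n.+2 -> {set 'I_n.+2}} | `[< generic R F >]]|
     <= #|good_tuples R n.+2 n.+2| * 2 ^ n.+1)%N.
Proof.
rewrite -card_avoid0 -cardsX.
apply: leq_trans (leq_imset_card (fun p : {ffun _} * {set _} => flip p.2 p.1) _).
apply: subset_leq_card; apply/subsetP => F; rewrite inE => /asboolP /generic_good[B B0 Bg].
apply/imsetP; exists (flip B F, B); last by rewrite /= flipK.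
apply/setXP; split=> //=; rewrite powersetE; apply/subsetP => i iB; rewrite !inE.
by apply: contraNneq B0 => <-.
Qed.

(* Multiplies the sign vectors of all sets but F i by that of F i; this turns a
   relation between the all-one vector and the F l, l != i, into one between the
   sets of twist i F. *)
Definition twist {n k : nat} (i : 'I_k) (F : {ffun 'I_k -> {set 'I_n}}) :
    {ffun 'I_k -> {set 'I_n}} :=
  [ffun l => if l == i then F i else ~: symd (F l) (F i)].

Lemma twistK (n k : nat) (i : 'I_k) : involutive (@twist n k i).
Proof.
move=> F; apply/ffunP => l; rewrite !ffunE eqxx; case: eqP => [->//|_].
apply/setP => j; rewrite !inE; by case: (j \in F l); case: (j \in F i).
Qed.

(** A nonzero relation with [mu i = 0] becomes, after [twist i], a kernel vector with [- c] in place
    [i]. There are [n] choices of [i], and each twist is a bijection. *)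
Lemma card_nongeneric_le (R : realType) (n : nat) :
  (#|[set F : {ffun 'I_n -> {set 'I_n}} | `[< ~ generic R F >]]| <= n * #|singular R n|)%N.
Proof.
have -> : (n * #|singular R n| = \sum_(i < n) #|[set twist i F | F in singular R n]|)%N.
  rewrite (eq_bigr (fun=> #|singular R n|)) => [|i _]; first by rewrite sum_nat_const card_ord.
  by rewrite card_imset //; exact: can_inj (twistK n n i).
apply: card_cover => F; rewrite inE => /asboolP ng.
have [mu [c [sol [i mui] [i' mui']]]] : exists mu : 'I_n -> R, exists c : R,
    [/\ forall j, \sum_i mu i * sg R (F i) j = c, exists i, mu i = 0 & exists i, mu i != 0].
  apply: contrapT => h; apply: ng => mu c sol ex i; apply/eqP/negPn/negP => mi.
  by apply: h; exists mu, c; split => //; exists i.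
exists i => //; apply/imsetP; exists (twist i F); last by rewrite twistK.
set G := twist i F.
pose V : 'M[R]_n := \matrix_(l, j) sg R (G l) j.
have : \det V == 0.
  apply/det0P; exists (\row_l (if l == i then - c else mu l)).
    apply/eqP => /rowP/(_ i'); rewrite !mxE; case: eqP => [e|_ e]; last by rewrite e eqxx in mui'.
    by move: mui'; rewrite e mui eqxx.
  apply/rowP => j; rewrite !mxE (bigD1 i) //= !mxE eqxx -(sol j) (bigD1 i) //= mui mul0r add0r.
  have sgi : sg R (G i) j = sg R (F i) j by rewrite /sg ffunE eqxx.
  rewrite sgi mulNr mulr_suml addrC; apply/eqP; rewrite subr_eq0; apply/eqP.
  apply: eq_bigr => l li; rewrite !mxE (negPf li) -mulrA; congr (_ * _).
  rewrite /sg ffunE (negPf li) !inE.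
  by case: (j \in F l); case: (j \in F i); rewrite /= ?mulr1 ?mulrNN ?mul1r ?mulr1.
(* The relation is between the rows, whereas [singular] asks for a vector orthogonal to every row;
   the determinant passes from one to the other. *)
rewrite -det_tr => /det0P[a a0 aV].
rewrite inE; apply/asboolP; exists a; split => //; first exact: submx1.
move=> l; move/rowP/(_ l): aV; rewrite !mxE => <-.
by apply: eq_bigr => j _; rewrite !mxE /sg; case: ifP; rewrite ?mulr1 ?mulrN1.
Qed.

Lemma card_good_ge (R : realType) (n : nat) :
  (2 ^ (n.+2 * n.+2) <= #|good_tuples R n.+2 n.+2| * 2 ^ n.+1 + n.+2 * #|singular R n.+2|)%N.
Proof.
rewrite -card_ffun_sets.
apply: leq_trans (leq_add (card_generic_le R n) (card_nongeneric_le R n.+2)).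
apply: leq_trans (leq_card_setU _ _); apply: subset_leq_card; apply/subsetP => F _.
by rewrite !inE; case: (pselect (generic R F)) => h; apply/orP; [left|right]; apply/asboolP.
Qed.

(** * From tuples back to collections, by number of members *)

Definition min_balanced_of_card (R : realType) (n k : nat) : {set {set {set 'I_n}}} :=
  [set Phi : {set {set 'I_n}} | `[< minimal_balanced R Phi >] && (#|Phi| == k)].

Lemma card_good_tuples (R : realType) (n k : nat) :
  #|good_tuples R n k| = (k`! * #|min_balanced_of_card R n k|)%N.
Proof.
rewrite mulnC -sum_nat_const -sum1_card.
rewrite (partition_big (fun F : {ffun 'I_k -> {set 'I_n}} => [set F i | i : 'I_k])
  (mem (min_balanced_of_card R n k))) /=; last first.
  move=> F; rewrite !inE => /andP[/injectiveP inj ->] /=.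
  by rewrite card_imset // card_ord.
apply: eq_bigr => Phi; rewrite inE => /andP[mb /eqP cPhi].
rewrite sum1_card.
have -> : (k`! = #|[set f in ffun_on (mem Phi) | injectiveb (f : {ffun 'I_k -> {set 'I_n}})]|)%N.
  by rewrite card_inj_ffuns_on card_ord cPhi ffactnn.
apply: eq_card => F.
transitivity ((F \in good_tuples R n k) && ([set F i | i : 'I_k] == Phi)); first by [].
rewrite [F \in good_tuples _ _ _]inE [RHS]inE; apply/andP/andP.
  move=> [/andP[inj _] /eqP e]; split=> //; apply/ffun_onP => i.
  by rewrite -e; apply: imset_f.
move=> [/ffun_onP on inj].
have e : [set F i | i : 'I_k] = Phi.
  apply/eqP; rewrite eqEcard card_imset ?card_ord ?cPhi ?leqnn ?andbT; last exact/injectiveP.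
  by apply/subsetP => S /imsetP[i _ ->]; exact: on.
by rewrite inj e mb eqxx.
Qed.

Lemma indep_tuple_leq (R : realType) (n k : nat) (F : {ffun 'I_k -> {set 'I_n}}) :
  indep_tuple R F -> (k <= n)%N.
Proof.
move=> ind; pose A : 'M[R]_(k, n) := \matrix_(i, j) (j \in F i)%:R.
have fr : row_free A.
  apply: inj_row_free => v /rowP vA; apply/rowP => i; rewrite [RHS]mxE.
  apply: (ind (fun i => v 0 i)) => j; move: (vA j); rewrite !mxE => h; rewrite -[RHS]h.
  by apply: eq_bigr => l _; rewrite mxE.
by rewrite -(eqP fr) rank_leq_col.
Qed.

Lemma minimal_balanced_card (R : realType) (n : nat) (Phi : {set {set 'I_n}}) :
  (0 < n)%N -> minimal_balanced R Phi -> (0 < #|Phi| <= n)%N.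
Proof.
move=> n0 mb; apply/andP; split.
  rewrite card_gt0; apply/negP => /eqP P0; case: mb => -[lam [_ /charvec_sumP lam1]] _.
  by move: (lam1 (Ordinal n0)); rewrite P0 big_set0 => /esym/eqP; rewrite oner_eq0.
pose F : {ffun 'I_#|Phi| -> {set 'I_n}} := [ffun i => enum_val i].
suff /good_tuplesP[lam [_ _ ind]] : F \in good_tuples R n #|Phi| by exact: indep_tuple_leq ind.
have -> : F \in good_tuples R n #|Phi| =
    injectiveb F && `[< minimal_balanced R [set F i | i : 'I_#|Phi|] >] by rewrite inE.
apply/andP; split.
  by apply/injectiveP => i i'; rewrite !ffunE; exact: enum_val_inj.
apply/asboolP; suff -> : [set F i | i : 'I_#|Phi|] = Phi by [].
apply/setP => S; apply/imsetP/idP => [[i _ ->]|SP]; first by rewrite ffunE enum_valP.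
by exists (enum_rank_in SP S) => //; rewrite ffunE enum_rankK_in.
Qed.

Lemma num_minimal_balanced_sum (R : realType) (n : nat) :
  num_minimal_balanced R n.+1 =
    (#|min_balanced_of_card R n.+1 n.+1| + \sum_(k < n) #|min_balanced_of_card R n.+1 k.+1|)%N.
Proof.
rewrite addnC -(big_ord_recr n (fun k => #|min_balanced_of_card R n.+1 k.+1|)) /=.
rewrite /num_minimal_balanced -sum1_card.
rewrite (partition_big (fun Phi : {set {set 'I_n.+1}} => inord #|Phi|.-1 : 'I_n.+1) predT) //=.
apply: eq_bigr => k _; rewrite sum1_card; apply: eq_card => Phi.
transitivity ((Phi \in [set Psi : {set {set 'I_n.+1}} | `[< minimal_balanced R Psi >]]) &&
  (inord #|Phi|.-1 == k)); first by [].
rewrite !inE; case: asboolP => //= mb.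
have /andP[P0 Pn] := @minimal_balanced_card R n.+1 Phi isT mb.
rewrite -val_eqE /= inordK; last by rewrite prednK.
by rewrite -[RHS]eqSS -(prednK P0) [in LHS]prednK.
Qed.

(** Each smaller size is at most [(n + 1) / 2^n] times the main term: going down by [j + 1] members
    costs at most [(n + 1)^(j + 1)] in the factorial, and [(n + 1)^j <= 2^(n j)]. *)
Lemma card_min_balanced_small (R : realType) (n k : nat) : (k < n)%N ->
  (#|min_balanced_of_card R n.+1 k.+1| * n.+1`! * 2 ^ n <= n.+1 * 2 ^ (n.+1 ^ 2 - n.+1 + 1))%N.
Proof.
move=> kn; have := card_good_le R n.+1 k; rewrite card_good_tuples.
set b := #|min_balanced_of_card _ _ _| => hb.
have [j jE] : exists j, n = (k + j.+1)%N by exists (n - k).-1; lia.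
have hf : (n.+1`! <= k.+1`! * n.+1 ^ j.+1)%N.
  have le : (j.+1 <= n.+1)%N by lia.
  rewrite -(ffact_fact le) mulnC (_ : n.+1 - j.+1 = k.+1)%N; last by lia.
  by rewrite leq_mul2l ffact_le_exp orbT.
have hp : (n.+1 ^ j.+1 <= n.+1 * 2 ^ (n * j))%N.
  rewrite expnS leq_mul2l expnM /=; case: j {hf jE} => // j.
  by rewrite leq_exp2r // ltn_expl.
rewrite -(leq_pmul2r (m := 2 ^ k)) ?expn_gt0 //.
have -> : (n.+1 * 2 ^ (n.+1 ^ 2 - n.+1 + 1) * 2 ^ k =
    2 ^ (n.+1 * k.+1) * (n.+1 * 2 ^ (n * j)) * 2 ^ n)%N.
  rewrite mulnCA -!mulnA; congr muln; rewrite -!expnD; congr expn.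
  rewrite expnS expn1; nia.
rewrite mulnAC leq_mul2r; apply/orP; right.
apply: (@leq_trans (b * (k.+1`! * (n.+1 * 2 ^ (n * j))) * 2 ^ k)).
  by rewrite leq_mul2r leq_mul2l (leq_trans hf) ?orbT // leq_mul2l hp orbT.
apply: (@leq_trans (k.+1`! * b * 2 ^ k * (n.+1 * 2 ^ (n * j)))); last by rewrite leq_mul2r hb orbT.
by apply: eq_leq; rewrite [RHS]mulnAC [(k.+1`! * b)%N]mulnC !mulnA.
Qed.

(** Collections of [n] members number at most the main term by [card_good_le], and [card_good_ge]
    limits the deficit by the singular tuples. The second error term is for the fewer than [n]
    smaller sizes. *)
Lemma num_minimal_balanced_ratio (R : realType) (n : nat) : (1 < n)%N ->
  `|(num_minimal_balanced R n)%:R * n`!%:R / 2 ^+ (n ^ 2 - n + 1) - 1| <=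
    n%:R * (#|singular R n|%:R / 2 ^+ (n * n)) + n%:R ^+ 2 / 2 ^+ n.-1 :> R.
Proof.
case: n => // -[//|n] _; set N := n.+2; rewrite [N.-1]/=.
rewrite num_minimal_balanced_sum -/N natrD.
set b := #|min_balanced_of_card R N N|; set lo := (\sum_(k < _) _)%N.
set E : R := 2 ^+ (N ^ 2 - N + 1).
have E0 : 0 < E by rewrite exprn_gt0.
have P0 : 0 < 2 ^+ n.+1 :> R by rewrite exprn_gt0.
have EP : 2 ^+ (N * N) = E * 2 ^+ n.+1.
  by rewrite -exprD; congr (_ ^+ _); rewrite /N expnS expn1; nia.
have hge := card_good_ge R n; have hle := card_good_le R N n.+1.
rewrite -/N card_good_tuples -/b in hge hle.
have hlo : (lo * N`! * 2 ^ n.+1 <= N ^ 2 * 2 ^ (N ^ 2 - N + 1))%N.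
  rewrite /lo !big_distrl /=.
  apply: (@leq_trans (\sum_(k < n.+1) N * 2 ^ (N ^ 2 - N + 1))).
    by apply: leq_sum => k _; apply: card_min_balanced_small.
  by rewrite sum_nat_const card_ord mulnA leq_mul2r /N; apply/orP; right; nia.
move: hge hle hlo; move: (N`!)%N => f; rewrite -!(ler_nat R) !(natrD, natrM, natrX) -/E EP.
set g : R := f%:R * b%:R; set s := #|singular R N|.
rewrite ler_pM2r // => hge hle; rewrite -ler_pdivlMr // => hlo.
have e1 : (b%:R + lo%:R) * f%:R / E - 1 = (g - E) / E + lo%:R * f%:R / E.
  by rewrite /g; field; rewrite gt_eqF.
have h0 : 0 <= lo%:R * f%:R / E by rewrite divr_ge0 ?mulr_ge0 // ltW.
have h1 : lo%:R * f%:R / E <= N%:R ^+ 2 / 2 ^+ n.+1.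
  by rewrite ler_pdivrMr // [leRHS]mulrAC.
have h2 : (g - E) / E <= 0 by rewrite pmulr_lle0 ?invr_gt0 // subr_le0.
have h3 : - (N%:R * (s%:R / (E * 2 ^+ n.+1))) <= (g - E) / E.
  rewrite ler_pdivlMr // -(ler_pM2r P0) mulrBl.
  have -> : - (N%:R * (s%:R / (E * 2 ^+ n.+1))) * E * 2 ^+ n.+1 = - (N%:R * s%:R).
    by field; rewrite !gt_eqF.
  lra.
have h4 : 0 <= N%:R * (s%:R / (E * 2 ^+ n.+1)) by rewrite !mulr_ge0 ?invr_ge0 ?mulr_ge0 ?(ltW E0) ?(ltW P0).
rewrite e1 ler_norml; apply/andP; split; lra.
Qed.

(** * Explicit rates of decay *)

Lemma sqr_le_exp2 (s : nat) : (s.+1 ^ 2 <= 8 * 2 ^ s)%N.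
Proof.
case: s => [|[|[|s]]] //.
elim: s => [//|s IHs]; rewrite expnS mulnCA; apply: leq_trans (leq_mul (leqnn 2) IHs).
by rewrite !expnS !expn0; lia.
Qed.

Lemma cube_le_exp2 (n : nat) : (n ^ 3 <= 8 * 2 ^ n)%N.
Proof.
case: n => [|[|[|[|n]]]] //.
elim: n => [//|n IHn]; rewrite [(2 ^ _)%N]expnS mulnCA.
apply: leq_trans (leq_mul (leqnn 2) IHn).
by rewrite !expnS !expn0; nia.
Qed.

(** Let [s] be the quotient of [n] by 32. One term of [(16 + 1)^n] gives
    [C(n, s) 16^(n - s) <= 17^n], so the product of the binomial coefficient and [(2/3)^(n - s)] is
    at most [(17/24)^n 24^s]. This is at most [2^-s], because [(17/24)^32 * 24 <= 1/2]. *)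
Lemma small_support_decay (R : realFieldType) (n : nat) : (0 < n)%N ->
  n%:R * ('C(n, n %/ 32)%:R * (4 * (2 / 3) ^+ (n.+1 - n %/ 32))) <= 2 ^+ 15 / n%:R :> R.
Proof.
move=> n0; set s := (n %/ 32)%N; set r := (n %% 32)%N.
have nE : n = (32 * s + r)%N by rewrite mulnC; exact: divn_eq.
have r32 : (r < 32)%N by rewrite ltn_mod.
have sn : (s <= n)%N by lia.
have hbin : 'C(n, s)%:R * 16 ^+ (n - s) <= 17 ^+ n :> R.
  rewrite -!natrX -natrM ler_nat (_ : 17 = 16 + 1)%N // expnDn.
  rewrite (bigD1 (Ordinal (leq_ltn_trans sn (ltnSn n)))) //= exp1n muln1.
  exact: leq_addr.
have hq : (17 / 24) ^+ 32 * 24 <= 1 / 2 :> R.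
  have h5 : (17 / 24) ^+ 5 <= 1 / 4 :> R by lra.
  have q0 : 0 <= 17 / 24 :> R by lra.
  have h30 : ((17 / 24) ^+ 5) ^+ 6 <= (1 / 4) ^+ 6 :> R.
    by apply: lerXn2r => //; rewrite nnegrE ?exprn_ge0 //; lra.
  have h2 : (17 / 24) ^+ 2 <= 1 :> R by apply: exprn_ile1; lra.
  have -> : (17 / 24) ^+ 32 = ((17 / 24) ^+ 5) ^+ 6 * (17 / 24) ^+ 2 :> R.
    by rewrite -exprM -exprD.
  have := ler_pM (exprn_ge0 6 (exprn_ge0 5 q0)) (exprn_ge0 2 q0) h30 h2; lra.
have hC : 'C(n, s)%:R * (2 / 3) ^+ (n.+1 - s) <= (1 / 2) ^+ s :> R.
  rewrite subSn // exprS.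
  have -> : 2 / 3 = 16 * (1 / 24) :> R by lra.
  have p0 k : 0 <= (1 / 24) ^+ k :> R by apply: exprn_ge0; lra.
  rewrite [(16 * _) ^+ _]exprMn.
  have h1 := ler_wpM2r (p0 (n - s)%N) hbin.
  have h0 : 0 <= 'C(n, s)%:R * 16 ^+ (n - s) * (1 / 24) ^+ (n - s) :> R.
    by apply: mulr_ge0 (p0 _); rewrite mulr_ge0 ?exprn_ge0.
  apply: (@le_trans _ _ (17 ^+ n * (1 / 24) ^+ (n - s))); first by lra.
  have -> : 17 ^+ n * (1 / 24) ^+ (n - s) = (17 / 24) ^+ n * 24 ^+ s :> R.
    have z24 : (24 : R) ^+ s != 0 by rewrite expf_eq0 pnatr_eq0 andbF.
    have e24 : (24 : R) ^+ n = 24 ^+ (n - s) * 24 ^+ s by rewrite -exprD subnK.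
    by rewrite !expr_div_n expr1n div1r e24 invfM mulrA mulfVK.
  rewrite {1}nE exprD exprM mulrAC -exprMn.
  have a0 : 0 <= (17 / 24) ^+ 32 * 24 :> R by rewrite mulr_ge0 // exprn_ge0 //; lra.
  have h2 : ((17 / 24) ^+ 32 * 24) ^+ s <= (1 / 2) ^+ s :> R.
    by apply: lerXn2r => //; rewrite nnegrE; lra.
  have h3 : (17 / 24) ^+ r <= 1 :> R by apply: exprn_ile1; lra.
  have h4 : 0 <= (17 / 24) ^+ r :> R by apply: exprn_ge0; lra.
  by have := ler_pM (exprn_ge0 s a0) h4 h2 h3; rewrite mulr1.
(* From [n <= 32 (s + 1)] and [(s + 1)^2 <= 8 * 2^s], as [32^2 * 8 = 2^13]. *)
have ns : n%:R ^+ 2 <= 2 ^+ 13 * 2 ^+ s :> R.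
  rewrite -!natrX -natrM ler_nat.
  apply: (@leq_trans ((32 * s.+1) ^ 2)); first by rewrite leq_exp2r //; lia.
  rewrite expnMn (_ : 2 ^ 13 = 32 ^ 2 * 8)%N; last by rewrite -(expnM 2 5 2) -(expnD 2 10 3).
  by rewrite -mulnA leq_mul2l sqr_le_exp2 orbT.
rewrite ler_pdivlMr ?ltr0n //.
set w := _ ^+ (n.+1 - s) in hC *; set C := _%:R in hC *.
have C0 : 0 <= C * w by rewrite mulr_ge0 // exprn_ge0 //; lra.
have h := ler_pM (exprn_ge0 2 (ler0n R n)) C0 ns hC.
have e : 2 ^+ s * (1 / 2) ^+ s = 1 :> R.
  by rewrite -exprMn (_ : 2 * (1 / 2) = 1) ?expr1n //; lra.
have h' : n%:R ^+ 2 * (C * w) <= 2 ^+ 13 by apply: le_trans h _; rewrite -mulrA e mulr1.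
have -> : 2 ^+ 15 = 4 * 2 ^+ 13 :> R by rewrite (exprD 2 2 13); congr (_ * _); ring.
have -> : n%:R * (C * (4 * w)) * n%:R = 4 * (n%:R ^+ 2 * (C * w)) by ring.
by rewrite ler_pM2l.
Qed.

(** The order [(log n)^3 / sqrt n] of the error, coming from level sets of size 3. The choice
    [l = 2 * up_log 2 n] ensures [2^-l <= n^-2], which is below the atom bound. *)
Definition log_scale (R : rcfType) (n : nat) : R :=
  (2 * up_log 2 n).+1%:R ^+ 3 / Num.sqrt n%:R.

(** The fourth power has [n^2] below and [(2 L + 1)^12] above, where [2 L + 1 <= 24 * 2^(L / 12)]
    and [2^L <= 2 n]; one factor [n] survives below and no logarithm remains. *)
Lemma log_scale_pow4 (R : rcfType) (n : nat) : (1 < n)%N ->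
  log_scale R n ^+ 4 <= 24 ^+ 12 * 2 / n%:R.
Proof.
move=> n1; set L := up_log 2 n; set q := (L %/ 12)%N.
have n0 : 0 < n%:R :> R by rewrite ltr0n ltnW.
have h1 : (2 * L).+1%:R <= 24 * 2 ^+ q :> R.
  have : (2 * L < 24 * q.+1)%N.
    by have := divn_eq L 12; have := ltn_pmod L (isT : 0 < 12)%N; rewrite -/q; lia.
  move=> h; rewrite -natrX -natrM ler_nat; apply: leq_trans h _.
  by rewrite leq_mul2l /= ltn_expl.
have h2 : 2 ^+ (q * 12) <= 2 * n%:R :> R.
  have /= /andP[lo _] := up_log_bounds (isT : 1 < 2)%N n1.
  have L0 : (0 < L)%N by rewrite up_log_gt0.
  rewrite -natrX -natrM ler_nat; apply: (@leq_trans (2 ^ L)).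
    by rewrite leq_exp2l // leq_divM.
  by rewrite -(prednK L0) expnS leq_mul2l /= ltnW.
have h3 : (2 * L).+1%:R ^+ 12 <= 24 ^+ 12 * (2 * n%:R) :> R.
  apply: (@le_trans _ _ ((24 * 2 ^+ q) ^+ 12)).
    by apply: lerXn2r; rewrite ?nnegrE ?mulr_ge0 ?exprn_ge0.
  by rewrite exprMn -exprM ler_wpM2l // exprn_ge0.
have s4 : Num.sqrt n%:R ^+ 4 = n%:R ^+ 2 :> R.
  by rewrite (exprM _ 2 2) sqr_sqrtr // ltW.
rewrite /log_scale -/L expr_div_n s4 -exprM ler_pdivrMr ?exprn_gt0 //.
by rewrite expr2 mulrA mulfVK ?gt_eqF // -[leRHS]mulrA.
Qed.

(** In [A], the 16 pays for the smaller collections, one [c] for small supports, one [c] for levels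
    of size at most 2, and [8 c^3] for the larger levels. *)
Lemma num_minimal_balanced_error (R : realType) (n : nat) :
    let c : R := 2 ^+ 16 in
    let A := 16 + 2 * c + 8 * c ^+ 3 in
    (1 < n)%N -> A * log_scale R n <= 1 ->
  `|(num_minimal_balanced R n)%:R * n`!%:R / 2 ^+ (n ^ 2 - n + 1) - 1| <= A * log_scale R n.
Proof.
move=> c A n1 hA; set z := log_scale R n in hA *.
have n0 : 0 < n%:R :> R by rewrite ltr0n ltnW.
have n0' := ltW n0; have n1' : 1 <= n%:R :> R by rewrite ler1n ltnW.
have c0 : 0 < c by rewrite exprn_gt0.
pose l := (2 * up_log 2 n)%N; pose s := (n %/ 32)%N.
set sq : R := Num.sqrt n%:R; have sq0 : 0 < sq by rewrite sqrtr_gt0.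
have sqn : sq * sq = n%:R by rewrite -expr2 sqr_sqrtr.
have sq1 : 1 <= sq by rewrite -[1](sqrtr1 R) ler_sqrt // ler1n ltnW.
have sqle : sq <= n%:R by rewrite -sqn ler_peMl // ltW.
pose v : R := l.+1%:R / sq.
have v0 : 0 <= v by rewrite divr_ge0 // ltW.
have l1 : 1 <= l.+1%:R :> R by rewrite ler1n.
have vz : v <= z.
  rewrite /z /log_scale -/l -/sq ler_pM2r ?invr_gt0 // exprS ler_peMr //.
  exact: exprn_ege1.
have nz : n%:R^-1 <= z.
  apply: le_trans vz; apply: (@le_trans _ _ sq^-1); first by rewrite lef_pV2 ?posrE.
  by rewrite ler_peMl // invr_ge0 ltW.
(* The cubic term of [card_singular_le], multiplied by [n], is exactly of order [z]. *)
have v3 : n%:R * v ^+ 3 = z.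
  rewrite /z /log_scale -/l -/sq /v expr_div_n -sqn; field.
  by rewrite gt_eqF.
have z0 : 0 <= z by apply: le_trans vz.
set t : R := s.+1%:R; set sr : R := Num.sqrt t.
have t0 : 0 < t by rewrite ltr0n.
have sr0 : 0 < sr by rewrite sqrtr_gt0.
have srt : sr * sr = t by rewrite -expr2 sqr_sqrtr // ltW.
have nt : n%:R <= 32 * t.
  have h : (n <= 32 * s.+1)%N by rewrite mulnC /s; exact: ltnW (ltn_ceil n _).
  by rewrite /t -natrM ler_nat.
have sqsr : sq <= 6 * sr.
  rewrite -(ler_pXn2r (n := 2)) ?nnegrE ?(ltW sq0) ?mulr_ge0 ?(ltW sr0) //.
  by rewrite exprMn !expr2 sqn srt; lra.
pose r : R := 12 / (t * sr); pose y := 2 * l.+1%:R * r.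
have tsr0 : 0 < t * sr by rewrite mulr_gt0.
have r0 : 0 < r by rewrite divr_gt0.
have nr : n%:R * sq * r <= 2 ^+ 12.
  rewrite /r mulrA ler_pdivrMr //.
  have := ler_pM n0' (ltW sq0) nt sqsr.
  have -> : 32 * t * (6 * sr) = 192 * (t * sr) by ring.
  have : 192 * 12 <= 2 ^+ 12 :> R by rewrite -natrX -natrM ler_nat.
  by nra.
have ny : 8 * n%:R * y <= c * v.
  have -> : 8 * n%:R * y = 2 ^+ 4 * (n%:R * sq * r) * v.
    by rewrite /y /v; field; rewrite gt_eqF.
  rewrite ler_wpM2r // /c (exprD 2 4 12) ler_wpM2l // exprn_ge0 //.
have y0 : 0 < y by apply: mulr_gt0 r0; rewrite -natrM ltr0n.
have ny0 : 0 <= 8 * n%:R * y by apply: mulr_ge0 (ltW y0); rewrite mulr_ge0.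
have cz0 : 0 <= c * z := mulr_ge0 (ltW c0) z0.
have c3z0 : 0 <= c ^+ 3 * z := mulr_ge0 (exprn_ge0 3 (ltW c0)) z0.
have cvz : c * v <= c * z by rewrite ler_pM2l.
have hsmall := small_support_decay R n (ltnW n1).
have hl : 2 ^- l <= r.
  have nl : n%:R ^+ 2 <= 2 ^+ l :> R.
    rewrite -!natrX ler_nat /l mulnC expnM leq_exp2r //; exact: up_logP.
  have tn : t <= n%:R by rewrite ler_nat ltn_Pdiv // ltnW.
  have srn : sr <= n%:R.
    apply: le_trans tn; rewrite -srt ler_peMl ?(ltW sr0) //.
    by rewrite -[1](sqrtr1 R) ler_sqrt // ler1n.
  have tl : t * sr <= 2 ^+ l.
    by apply: le_trans nl; rewrite expr2; apply: ler_pM => //; exact: ltW.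
  rewrite /r ler_pdivlMr // mulrC ler_pdivrMr ?exprn_gt0 //.
  by apply: le_trans tl _; rewrite ler_peMl ?exprn_ge0 // ler1n.
(* The left side is at most [2 c z], hence at most [A z]. *)
have hy : 16 * n%:R * y <= 1 by rewrite /A in hA; lra.
have sing := @card_singular_le R n s l (ltnW n1) (leq_div n 32) hl hy.
rewrite -/t -/sr -/r -/y in sing.
have Q0 : 0 < 2 ^+ (n * n) :> R by rewrite exprn_gt0.
apply: le_trans (num_minimal_balanced_ratio R n n1) _.
have h1 : n%:R * (#|singular R n|%:R / 2 ^+ (n * n)) <=
   n%:R * ('C(n, s)%:R * (4 * (2 / 3) ^+ (n.+1 - s)) + 8 * y + 8 * (8 * n%:R * y) ^+ 3).
  by rewrite ler_wpM2l // ler_pdivrMr.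
have h2 : n%:R ^+ 2 / 2 ^+ n.-1 <= 16 * z.
  apply: (@le_trans _ _ (16 * n%:R^-1)); last by rewrite ler_pM2l.
  rewrite ler_pdivrMr ?exprn_gt0 // mulrAC ler_pdivlMr // -exprSr.
  have -> : 16 * 2 ^+ n.-1 = 8 * 2 ^+ n :> R.
    by rewrite -{2}(prednK (ltnW n1)) exprS; ring.
  by rewrite -!natrX -natrM ler_nat cube_le_exp2.
have h3 : n%:R * (8 * y) <= c * z by lra.
have h4 : n%:R * (8 * (8 * n%:R * y) ^+ 3) <= 8 * c ^+ 3 * z.
  have h : (8 * n%:R * y) ^+ 3 <= (c * v) ^+ 3 by apply: lerXn2r; rewrite ?nnegrE // mulr_ge0 // ltW.
  have -> : 8 * c ^+ 3 * z = n%:R * (8 * (c * v) ^+ 3).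
    by rewrite -v3 [(c * v) ^+ 3]exprMn mulrCA !mulrA.
  by rewrite ler_wpM2l // ler_pM2l.
have h5 : 2 ^+ 15 / n%:R <= c * z.
  apply: le_trans (_ : c * n%:R^-1 <= _); last by rewrite ler_pM2l.
  by rewrite ler_pM2r ?invr_gt0 // /c ler_weXn2l // ler1n.
move: h1; rewrite 2!mulrDr /A; lra.
Qed.

(* Passage to the limit *)
From mathcomp Require Import classical_sets topology normedtype sequences.
Import numFieldNormedType.Exports.

Local Open Scope classical_set_scope.
Local Open Scope ring_scope.

Theorem theorem1 (R : realType) :
  exists eps : nat -> R,
    (eps n @[n --> \oo] --> (0 : R)) /\
    forall n : nat, (0 < n)%N ->
      (num_minimal_balanced R n)%:R =
        (2 ^+ (n ^ 2 - n + 1)%N / (n`!)%:R) * (1 + eps n) :> R.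
Proof.
exists (fun n => (num_minimal_balanced R n)%:R * n`!%:R / 2 ^+ (n ^ 2 - n + 1) - 1).
split; last first.
  move=> n _; rewrite addrC subrK; field.
  by rewrite expf_neq0 ?pnatr_eq0 // -lt0n fact_gt0.
apply/cvgr0Pnorm_lt => e e0.
pose c : R := 2 ^+ 16; pose A := 16 + 2 * c + 8 * c ^+ 3.
have c0 : 0 < c by rewrite exprn_gt0.
have A0 : 0 < A by rewrite !addr_gt0 ?mulr_gt0 ?exprn_gt0.
(* The minimum with 1 secures the condition [A * log_scale R n <= 1] of the error bound. *)
pose d := Num.min e 1; have d0 : 0 < d by rewrite lt_min e0 ltr01.
near=> n.
have n1 : (1 < n)%N by near: n; exact: nbhs_infty_gt.
have n0 : 0 < n%:R :> R by rewrite ltr0n ltnW.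
have hn : A ^+ 4 * (24 ^+ 12 * 2) / d ^+ 4 < n%:R by near: n; exact: nbhs_infty_gtr.
have z0 : 0 <= log_scale R n by rewrite divr_ge0 ?exprn_ge0 ?sqrtr_ge0.
have Az : A * log_scale R n < d.
  have Az0 := mulr_ge0 (ltW A0) z0.
  rewrite -(ltr_pXn2r (n := 4)) ?nnegrE ?(ltW d0) // exprMn.
  have h := ler_wpM2l (exprn_ge0 4 (ltW A0)) (log_scale_pow4 R n n1).
  apply: le_lt_trans h _; rewrite mulrA ltr_pdivrMr // [d ^+ 4 * _]mulrC.
  by move: hn; rewrite ltr_pdivrMr ?exprn_gt0.
have [de d1] : d <= e /\ d <= 1 by rewrite /d !ge_min !lexx orbT.
apply: le_lt_trans (lt_le_trans Az de).
exact: num_minimal_balanced_error n1 (ltW (lt_le_trans Az d1)).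
Unshelve. all: by end_near.
Qed.
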